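(* Let $A$ be a real $d\times n$ matrix of rank $d$ with no zero columns, let $\mathcal{L}^{-1}\subset\mathbb{P}^{n-1}$ be the reciprocal plane of its row space, and let $\mathcal{R}_A$ be its ramification scheme. Then $\mathcal{R}_A$ contains the singular locus $\mathrm{Sing}(\mathcal{L}^{-1})$, and the sets of real points coincide: $$(\mathcal{R}_A)_{\mathbb{R}} \;=\; \mathrm{Sing}(\mathcal{L}^{-1})_{\mathbb{R}}.$$
   Context: Let $\mathcal{L}\subset\mathbb{C}^n$ be the row space of $A$. The reciprocal plane $\mathcal{L}^{-1}\subset\mathbb{P}^{n-1}$ (complex projective space) is the Zariski closure of $\{(1/u_1:\dots:1/u_n): u\in\mathcal{L}\cap(\mathbb{C}^* )^n\}$, an irreducible variety of dimension $d-1$ with homogeneous prime ideal $I(\mathcal{L}^{-1})\subset\mathbb{C}[x_1,\dots,x_n]$. A circuit is an inclusion-minimal set of indices of linearly dependent columns of $A$. For each circuit $C$ fix a vector $v\in\mathbb{R}^n$ in $\ker A$ with $\mathrm{supp}(v)=C$; let $\mathcal{C}(A)$ be the set of these vectors, and $h_v(\mathbf{x})=\sum_{i\in\mathrm{supp}(v)}v_i\prod_{j\in\mathrm{supp}(v)\setminus\{i\}}x_j$. Let $\mathrm{Jac}(\mathcal{L}^{-1})$ be the matrix with rows $\nabla h_v(\mathbf{x})$, $v\in\mathcal{C}(A)$. The ramification scheme is $\mathcal{R}_A=\mathrm{Proj}(\mathbb{C}[\mathbf{x}]/J_A)$, where $$J_A=\Bigl(I(\mathcal{L}^{-1})+\bigl\langle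 n\times n\text{ minors of }\begin{pmatrix}A\\ \mathrm{Jac}(\mathcal{L}^{-1})\end{pmatrix}\bigr\rangle\Bigr):\bigl\langle (n-d)\times(n-d)\text{ minors of }\mathrm{Jac}(\mathcal{L}^{-1})\bigr\rangle^{\infty}.$$ Its underlying set is the Zariski closure of the set of regular points of $\mathcal{L}^{-1}$ at which the morphism $\mathcal{L}^{-1}\to\mathbb{P}^{d-1}$, $\mathbf{x}\mapsto A\mathbf{x}$, is ramified. For a subvariety or subscheme $X\subset\mathbb{P}^{n-1}$, $X_{\mathbb{R}}$ denotes its set of real points, i.e. points of $X$ that have real homogeneous coordinates. *)

(* Defs.v *)
From mathcomp Require Import all_boot all_order all_algebra.
From mathcomp Require Import complex boolp classical_sets reals mpoly.

Set Implicit Arguments.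
Unset Strict Implicit.
Unset Printing Implicit Defensive.

Import Order.TTheory GRing.Theory Num.Theory.
Local Open Scope classical_set_scope.
Local Open Scope ring_scope.

Section Ideals.
Variable S : comNzRingType.
Implicit Types (G I J : set S).

Definition ideal_span G : set S :=
  [set f | exists2 s : seq (S * S),
     (forall cg, cg \in s -> G cg.2) & f = \sum_(cg <- s) cg.1 * cg.2].

Definition ideal_add I J : set S :=
  [set f | exists a b, [/\ I a, J b & f = a + b]].

(* J ^ 0 is the unit ideal: the empty product is 1. *)
Definition ideal_pow J (k : nat) : set S :=
  ideal_span [set f | exists2 g : 'I_k -> S,
                        (forall i, J (g i)) & f = \prod_(i < k) g i].

(* I : J^oo is the union over k of the ideal quotients I : J^k. *)
Definition saturation I J : set S :=
  [set f | exists k : nat, forall g, ideal_pow J k g -> I (f * g)].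

(* There is exactly one 0 x 0 minor, and it is equal to 1. *)
Definition minors (k p q : nat) (M : 'M[S]_(p, q)) : set S :=
  [set m | exists (f : 'I_k -> 'I_p) (g : 'I_k -> 'I_q),
     [/\ {homo f : i j / (i < j)%N}, {homo g : i j / (i < j)%N}
       & m = \det (mxsub f g M)]].

End Ideals.

(* A subset of the projective space P^(n-1) over C is given by the set of all
   (nonzero) vectors of homogeneous coordinates of its points. *)
Section Projective.
Variables (C : fieldType) (n : nat).
Implicit Types (X : set 'rV[C]_n) (J : set {mpoly C[n]}) (p : 'rV[C]_n).

Definition homogeneous (f : {mpoly C[n]}) : Prop :=
  exists k : nat, f \is k.-homog.

(* The zero locus in P^(n-1) of a homogeneous ideal J, that is, the set of
   closed points of Proj (C[x] / J). *)
Definition proj_zeros J : set 'rV[C]_n :=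
  [set p : 'rV[C]_n | p != 0 /\ forall f, homogeneous f -> J f -> f.@[p 0] = 0].

Definition proj_ideal X : set {mpoly C[n]} :=
  ideal_span [set f : {mpoly C[n]} | homogeneous f /\ forall p, X p -> f.@[p 0] = 0].

Definition zariski_closure X : set 'rV[C]_n := proj_zeros (proj_ideal X).

(* Jacobian criterion: for X closed and irreducible of codimension c in P^(n-1),
   p is singular on X when the gradients at p of the elements of the homogeneous
   ideal of X span a space of dimension < c, i.e. when the Zariski tangent space
   of X at p has dimension > dim X. *)
Definition sing_locus (c : nat) X : set 'rV[C]_n :=
  [set p : 'rV[C]_n | X p /\
     forall (m : nat) (F : 'I_m -> {mpoly C[n]}),
       (forall k, proj_ideal X (F k)) ->
       (\rank (\matrix_(k < m, j < n) ((F k)^`M(j)).@[p 0])%R < c)%N].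

End Projective.

Section ReciprocalPlane.
Variables (R : realType) (d n : nat).
Implicit Types (A : 'M[R]_(d, n)) (v : 'cV[R]_n).

Definition real_points (X : set 'rV[R[i]]_n) : set 'rV[R[i]]_n :=
  [set p : 'rV[R[i]]_n | X p /\ exists2 c : R[i], c != 0 &
             exists x : 'rV[R]_n, c *: p = map_mx (real_complex R) x].

(* The points (1/u_1 : ... : 1/u_n), u in the complex row space of A with all
   coordinates nonzero. *)
Definition reciprocal_torus A : set 'rV[R[i]]_n :=
  [set p : 'rV[R[i]]_n | exists y : 'rV[R[i]]_d,
     let u := y *m map_mx (real_complex R) A in
     (forall j, u 0 j != 0) /\ p = map_mx GRing.inv u].

Definition reciprocal_plane A : set 'rV[R[i]]_n :=
  zariski_closure (reciprocal_torus A).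

Definition dependent_cols A (D : {set 'I_n}) : bool :=
  ~~ row_free (rowsub (fun k : 'I_#|D| => enum_val k) A^T).

Definition circuits A : {set {set 'I_n}} :=
  [set D : {set 'I_n} | minset (dependent_cols A) D]%SET.

Definition supp v : {set 'I_n} := [set i | v i 0 != 0]%SET.

(* cv D is the vector chosen for the circuit D; the values of cv outside of
   the circuits are irrelevant. *)
Definition circuit_vectors A (cv : {set 'I_n} -> 'cV[R]_n) : Prop :=
  forall D, D \in circuits A -> A *m cv D = 0 /\ supp (cv D) = D.

Definition circuit_poly v : {mpoly R[i][n]} :=
  \sum_(i in supp v) ((v i 0)%:C)%C%:MP * \prod_(j in supp v :\ i) 'X_j.

Definition jac A (cv : {set 'I_n} -> 'cV[R]_n) :
    'M[{mpoly R[i][n]}]_(#|circuits A|, n) :=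
  \matrix_(k, j) (circuit_poly (cv (enum_val k)))^`M(j).

Definition ramification_ideal A (cv : {set 'I_n} -> 'cV[R]_n) :
    set {mpoly R[i][n]} :=
  saturation
    (ideal_add (proj_ideal (reciprocal_plane A))
       (ideal_span (minors n
          (col_mx (map_mx (fun a : R => (a%:C)%C%:MP) A) (jac A cv)))))
    (ideal_span (minors (n - d) (jac A cv))).

Definition ramification_scheme A (cv : {set 'I_n} -> 'cV[R]_n) :
    set 'rV[R[i]]_n :=
  proj_zeros (ramification_ideal A cv).

(* The reciprocal plane of a matrix of rank d has dimension d - 1, hence
   codimension n - d in P^(n-1). *)
Definition sing_reciprocal_plane A : set 'rV[R[i]]_n :=
  sing_locus (n - d) (reciprocal_plane A).

End ReciprocalPlane.

(* Main.v *)
Require Import Defs.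
From mathcomp Require Import all_boot all_order all_algebra ring.
From mathcomp Require Import complex boolp classical_sets reals mpoly.

(* Write K for the kernel of A, u = y A for a vector of the row space, and let p
   be a point of the reciprocal plane with support S.  The circuit polynomials
   show that S is a flat and that 1/p agrees on S with some vector of the row
   space.  The kernel of the Jacobian of the circuit polynomials at p is the
   space T of the w such that sum_S v_j w_j / p_j^2 = 0 for v in K supported on
   S, and v_b w_a + v_a w_b = 0 for v in K supported on S + {a, b}.  Curves 1/u
   with u tending to 1/p show that T is tangent to the reciprocal plane: their
   derivatives span T by partial fractions along a generic line of row vectors
   annihilating the columns of S.  So the circuit polynomials compute the
   singular locus, although it is not needed that they generate the ideal.

   If p is real and regular, then T has dimension at most d, and A : T -> C^d is
   onto: for a functional y vanishing on A T, pairing y A with conj(y A) p^2 on S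
   and then with 1/(y A) outside of S gives y A = 0.  Hence some n x n minor does
   not vanish at p.

   If p is singular, then T has dimension greater than d.  Hence T contains a
   nonzero w supported outside of S with sum_j (y A)_j w_j = 0 for all y
   annihilating the columns of S.  On the space of these w, consider the form
   sum_j (l_j(e) + t l_j(f))^2 w_j conj(w'_j), where l_j(y) = (y A)_j and e, f are
   real and generic.  Its determinant has positive degree in t and no real root,
   so it has a nonreal root t0.  It is a limit of roots t(s), s -> 0, of the
   equation expressing that 1/u is a ramification point for the vector
   u = (s y + e + t f) A, where y A = 1/p on S.  As s 1/u tends to p, every
   polynomial vanishing at the ramification points vanishes at p. *)

Set Implicit Arguments.
Unset Strict Implicit.
Unset Printing Implicit Defensive.
Import Order.TTheory GRing.Theory Num.Theory.
Local Open Scope ring_scope.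

(** * Generic points for univariate polynomials *)

Section PolyVanishing.
Variable F : numFieldType.
Implicit Types p q : {poly F}.

(** In characteristic 0 the first [size p] natural numbers are distinct, too many to be all roots.
    Natural numbers are real, which keeps the generic choices below real. *)
Lemma poly_exists_nonroot p : p != 0 -> exists k : nat, p.[k%:R] != 0.
Proof.
move=> p0.
have /allPn[x] : ~~ all (root p) [seq k%:R | k <- iota 0 (size p)].
  apply/negP => /max_poly_roots; rewrite size_map size_iota ltnn => H.
  suff: false by []; apply: H => //.
  by rewrite map_inj_uniq ?iota_uniq //; apply: mulrIn; rewrite oner_eq0.
by case/mapP=> k _ -> /= rk; exists k.
Qed.

Lemma poly_eq0_cofinite p q :
  q != 0 -> (forall x, q.[x] != 0 -> p.[x] = 0) -> p = 0.
Proof.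
move=> q0 H; apply/eqP; case: (eqVneq p 0) => // p0.
have /poly_exists_nonroot[k] : p * q != 0 by rewrite mulf_neq0.
rewrite hornerM; have [->|/H->] := eqVneq q.[k%:R] 0.
  by rewrite mulr0 eqxx.
by rewrite mul0r eqxx.
Qed.

Lemma horner_prod_neq0 (I : finType) (P : pred I) (g : I -> {poly F}) x :
  ((\prod_(i | P i) g i).[x] != 0) = [forall (i | P i), (g i).[x] != 0].
Proof.
rewrite horner_prod; apply/prodf_neq0/forall_inP => H i Pi; exact: H.
Qed.

(** Along the moment curve (1, x, x^2, ...) each value is a polynomial in x with coefficients
    [K *m g i], hence nonzero. A nonroot of the product of these polynomials serves all [i] at
    once. *)
Lemma generic_combination (m d : nat) (I : finType) (P : pred I)
    (K : 'M[F]_(m, d)) (g : I -> 'cV[F]_d) :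
  (forall i, P i -> K *m g i != 0) ->
  exists k : nat, forall i, P i ->
    ((\row_(j < m) (k%:R : F) ^+ j) *m K *m g i) 0 0 != 0.
Proof.
move=> H.
pose q i := \sum_(j < m) (K *m g i) j 0 *: 'X^j.
have q0 i : P i -> q i != 0.
  move=> /H; apply: contraNneq => qi0; apply/eqP/matrixP => j k.
  rewrite (ord1 k) [RHS]mxE.
  have := congr1 (fun r : {poly F} => r`_j) qi0.
  rewrite coef0 coef_sum (bigD1 j) //= coefZ coefXn eqxx mulr1 big1 ?addr0 //.
  by move=> l lj; rewrite coefZ coefXn eq_sym (inj_eq val_inj) (negbTE lj) mulr0.
have /poly_exists_nonroot[k] : \prod_(i | P i) q i != 0.
  by apply/prodf_neq0 => i /q0.
rewrite horner_prod_neq0 => /forall_inP Hk; exists k => i /Hk.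
suff -> : (q i).[k%:R] = ((\row_(j < m) (k%:R : F) ^+ j) *m K *m g i) 0 0 by [].
rewrite -mulmxA [RHS]mxE horner_sum; apply: eq_bigr => j _.
by rewrite hornerZ hornerXn mulrC [in RHS]mxE.
Qed.

End PolyVanishing.

(** * Divisibility from common roots *)

Section ClosedField.
Variable C : closedFieldType.

(** Each linear factor of [g], counted with multiplicity, divides [h], and [size g] exceeds the
    number of these factors by one. *)
Lemma dvdp_exp_roots (g h : {poly C}) :
  g != 0 -> (forall x, root g x -> root h x) -> g %| h ^+ size g.
Proof.
move=> g0 H; have [r gE] := closed_field_poly_normal g.
have lg0 : lead_coef g != 0 by rewrite lead_coef_eq0.
have rh x : x \in r -> root h x.
  by move=> xr; apply: H; rewrite gE rootZ // root_prod_XsubC.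
have -> : size g = (size r).+1 by rewrite gE size_scale // size_prod_XsubC.
rewrite gE dvdpZl // exprS; apply: dvdp_mull.
elim: r rh {gE} => [|x r IHr] rh; first by rewrite big_nil dvd1p.
rewrite big_cons exprS dvdp_mul //.
  by rewrite dvdp_XsubCl; apply: rh; rewrite mem_head.
by apply: IHr => y yr; apply: rh; rewrite in_cons yr orbT.
Qed.

End ClosedField.

(** * Specialization of plane curves *)

Section Specialization.
Variable C : numClosedFieldType.
Implicit Types (G N : {poly {poly C}}) (s t : C).

(** In [{poly {poly C}}] the outer variable is t and the inner one is s, so that [G.[t%:P].[s]] is
    G(s, t). Only s is specialized here. *)
Definition eval_coefs s : {poly {poly C}} -> {poly C} := map_poly (horner_eval s).

Lemma eval_coefsE G s t : G.[t%:P].[s] = (eval_coefs s G).[t].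
Proof.
by rewrite -[in RHS](hornerC t s) -/(horner_eval s t%:P) horner_map.
Qed.

Lemma eval_coefs_eq0 G (q : {poly C}) :
  q != 0 -> (forall s, q.[s] != 0 -> eval_coefs s G = 0) -> G = 0.
Proof.
move=> q0 H; apply/polyP => i; rewrite coef0.
apply: (poly_eq0_cofinite q0) => s /H /(congr1 (fun r : {poly C} => r`_i)).
by rewrite coef0 coef_map.
Qed.

Lemma eval_coefs0_eq0 G : eval_coefs 0 G = 0 -> exists H, G = 'X%:P * H.
Proof.
move=> G0; exists (map_poly (fun q : {poly C} => q %/ 'X) G).
apply/polyP => i; rewrite coefCM coef_map_id0 ?div0p //.
have /(congr1 (fun r : {poly C} => r`_i)) := G0.
rewrite coef0 coef_map /= /horner_eval => /eqP; rewrite -/(root _ _) -dvdp_XsubCl.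
by rewrite subr0 mulrC => /divpK.
Qed.

(** The inner variable is prime and does not divide [G], so it divides [q]; one factor is cancelled
    at a time. *)
Lemma cancel_polyX G H (q : {poly {poly C}}) k :
  eval_coefs 0 G != 0 -> ('X ^+ k)%:P * H = q * G -> exists q', H = q' * G.
Proof.
move=> G0; elim: k q => [|k IHk] q; first by rewrite mul1r => ->; exists q.
rewrite exprS polyCM => E.
have /eval_coefs0_eq0[q1 qE] : eval_coefs 0 q = 0.
  have /(congr1 (eval_coefs 0)) := E; rewrite /eval_coefs !rmorphM /= map_polyC /=.
  rewrite /horner_eval hornerX !mul0r => /esym/eqP.
  by rewrite mulf_eq0 -!/(eval_coefs _ _) (negbTE G0) orbF => /eqP.
apply: (IHk q1); apply: (@mulfI _ 'X%:P); first by rewrite polyC_eq0 polyX_eq0.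
by rewrite mulrA E qE mulrA.
Qed.

(* A component of the curve G = 0 through (0, t0) is not contained in the line
   s = 0, and N vanishes on it away from that line, hence at (0, t0).  This is
   made algebraic by pseudo-dividing a power of N by G. *)
Lemma specialization G N t0 :
  eval_coefs 0 G != 0 ->
  (forall s t, s != 0 -> G.[t%:P].[s] = 0 -> N.[t%:P].[s] = 0) ->
  G.[t0%:P].[0] = 0 -> N.[t0%:P].[0] = 0.
Proof.
move=> G0 H Gt0.
have Gn0 : G != 0 by apply: contraNneq G0 => ->; rewrite /eval_coefs rmorph0.
pose c := lead_coef G; have c0 : c != 0 by rewrite lead_coef_eq0.
pose Nn := N ^+ size G.
pose k := Pdiv.Ring.rscalp Nn G.
have E := Pdiv.ComRing.rdivp_eq G Nn.
(* If s c(s) != 0, specialization keeps the degree of [G]. The specialized [G] then divides the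
   specialized remainder, which has smaller degree and so is 0; this holds for all but finitely many
   s. *)
have r0 : Pdiv.Ring.rmodp Nn G = 0.
  apply: (@eval_coefs_eq0 _ ('X * c)); first by rewrite mulf_neq0 // polyX_eq0.
  move=> s; rewrite hornerM hornerX mulf_eq0 negb_or => /andP[s0 cs].
  have sG : size (eval_coefs s G) = size G by rewrite size_map_poly_id0.
  have Gs0 : eval_coefs s G != 0 by rewrite -size_poly_eq0 sG size_poly_eq0.
  have dv : eval_coefs s G %| eval_coefs s Nn.
    rewrite /eval_coefs rmorphXn /= -sG; apply: dvdp_exp_roots => // x /rootP.
    by rewrite -!eval_coefsE => /(H _ _ s0) Nx; apply/rootP; rewrite -eval_coefsE.
  apply/eqP; case: (eqVneq (eval_coefs s (Pdiv.Ring.rmodp Nn G)) 0) => // rs0.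
  have : eval_coefs s G %| eval_coefs s (Pdiv.Ring.rmodp Nn G).
    have /(congr1 (eval_coefs s)) := E.
    rewrite /eval_coefs linearZ_LR rmorphD rmorphM /= -!/(eval_coefs _ _) => Es.
    rewrite -(@dvdp_addr _ (eval_coefs s (Pdiv.Ring.rdivp Nn G) * eval_coefs s G)) ?dvdp_mulIr //.
    rewrite -Es /= -mul_polyC; exact: dvdp_mull.
  move=> /(dvdp_leq rs0); rewrite sG leqNgt => /negP[].
  by rewrite (leq_ltn_trans (size_poly _ _)) // Pdiv.Ring.ltn_rmodp.
rewrite r0 addr0 in E.
(* Write c = s^m c1 with c1(0) != 0. Cancelling the power of s leaves a factor that survives at s =
   0. *)
have [m [c1]] := multiplicity_XsubC c 0.
rewrite c0 subr0 mulrC /= => c10 cE.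
have : exists q', (c1 ^+ k)%:P * Nn = q' * G.
  apply: (@cancel_polyX _ _ (Pdiv.Ring.rdivp Nn G) (m * k)) => //.
  by rewrite -E mulrA -polyCM exprM -exprMn -cE mul_polyC.
case=> q' /(congr1 (fun P : {poly {poly C}} => P.[t0%:P].[0])).
rewrite !hornerM Gt0 mulr0 hornerC /Nn !horner_exp => /eqP.
by rewrite mulf_eq0 !expf_eq0 -/(root c1 0) (negbTE c10) andbF /= => /andP[_ /eqP].
Qed.

End Specialization.

(** * Evaluation, derivatives and homogeneity of multivariate polynomials *)

Section MPolyEval.
Variable n : nat.

Lemma meval_homog (S : comNzRingType) (f : {mpoly S[n]}) k (c : S)
    (h h' : 'I_n -> S) :
  f \is k.-homog -> (forall i, h' i = c * h i) -> f.@[h'] = c ^+ k * f.@[h].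
Proof.
move=> /dhomogP hf h'E; rewrite !mevalE mulr_sumr !big_seq.
apply: eq_bigr => m /hf <-; rewrite mulrCA; congr (_ * _).
rewrite (eq_bigr (fun i => c ^+ m i * h i ^+ m i)); last first.
  by move=> i _; rewrite h'E exprMn.
by rewrite big_split /= mdegE expr_sum.
Qed.

Variable C : fieldType.
Implicit Types f : {mpoly C[n]}.

Lemma horner_mmap f (Y : 'I_n -> {poly C}) s :
  (mmap polyC Y f).[s] = f.@[fun j => (Y j).[s]].
Proof.
rewrite [mmap _ _ _]/mmap horner_sum mevalE; apply: eq_bigr => m _.
rewrite hornerM hornerC /mmap1 horner_prod; congr (_ * _).
by apply: eq_bigr => i _; rewrite horner_exp.
Qed.

Lemma horner_horner_mmap f (Y : 'I_n -> {poly {poly C}}) s t :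
  (mmap (polyC \o polyC) Y f).[t%:P].[s] = f.@[fun j => (Y j).[t%:P].[s]].
Proof.
rewrite [mmap _ _ _]/mmap !horner_sum mevalE; apply: eq_bigr => m _.
rewrite /= !hornerM !hornerC /mmap1 !horner_prod; congr (_ * _).
by apply: eq_bigr => i _; rewrite !horner_exp.
Qed.

(** This chain rule is linear in [f] and stable under products by Leibniz, so it reduces to 1 and
    the variables. *)
Lemma deriv_mmap f (Y : 'I_n -> {poly C}) :
  (mmap polyC Y f)^`() = \sum_j mmap polyC Y f^`M(j) * (Y j)^`().
Proof.
elim/mpolyind: f => [|c m f _ _ IHf].
  rewrite mmap0 deriv0 big1 // => j _.
  by rewrite mderiv0 mmap0 mul0r.
rewrite mmapD derivD IHf.
rewrite [RHS](eq_bigr (fun j => mmap polyC Y (c *: 'X_[m])^`M(j) * (Y j)^`() +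
    mmap polyC Y f^`M(j) * (Y j)^`())); last first.
  by move=> j _; rewrite mderivD mmapD mulrDl.
rewrite big_split /=; congr (_ + _).
rewrite mmapZ mmapX mul_polyC derivZ.
rewrite (eq_bigr (fun j => c *: (mmap polyC Y 'X_[m]^`M(j) * (Y j)^`()))); last first.
  by move=> j _; rewrite mderivZ mmapZ /= mul_polyC scalerAl.
rewrite -scaler_sumr; congr (_ *: _).
pose D (q : {mpoly C[n]}) := (mmap polyC Y q)^`() = \sum_j mmap polyC Y q^`M(j) * (Y j)^`().
have D1 : D 1.
  rewrite /D mmapC derivC big1 // => j _.
  by rewrite mderivC mmap0 mul0r.
have DM q r : D q -> D r -> D (q * r).
  rewrite /D rmorphM derivM => -> ->; rewrite mulr_suml mulr_sumr -big_split.
  by apply: eq_bigr => j _; rewrite mderivM rmorphD !rmorphM /= mulrDl mulrAC mulrA.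
have DX i : D 'X_i.
  rewrite /D mmapX mmap1U (bigD1 i) //= big1 ?addr0.
    by rewrite mderivX mnmE eqxx scale1r -{1}[U_(i)%MM]add0m addmK mpolyX0 mmapC mul1r.
  move=> j ji.
  by rewrite mderivX mnmE eq_sym (negbTE ji) scale0r mmap0 mul0r.
suff : D 'X_[m] by rewrite /D mmapX.
rewrite mpolyXE_id; elim/big_ind: _ => // i _.
by elim: (m i) => [|k IH]; rewrite ?expr0 // exprS; apply: DM.
Qed.

Lemma mderiv_prodX0 (j : 'I_n) (D : {set 'I_n}) : j \notin D ->
  (\prod_(k in D) 'X_k : {mpoly C[n]})^`M(j) = 0.
Proof.
move=> jD; elim/big_ind: _ => [|p q Hp Hq|i iD].
- by rewrite mderivC.
- by rewrite mderivM Hp Hq mul0r mulr0 addr0.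
- rewrite mderivX mnmE; case: eqP => [ij|_]; last by rewrite scale0r.
  by rewrite -ij iD in jD.
Qed.

Lemma mderiv_prodX (j : 'I_n) (D : {set 'I_n}) :
  (\prod_(k in D) 'X_k : {mpoly C[n]})^`M(j) =
  if j \in D then \prod_(k in D :\ j) 'X_k else 0.
Proof.
case: ifPn => [jD|]; last exact: mderiv_prodX0.
rewrite (big_setD1 _ jD) /= mderivM mderiv_prodX0 ?mulr0 ?addr0 ?setD11 //.
by rewrite mderivX mnmE eqxx scale1r -{1}[U_(j)%MM]add0m addmK mpolyX0 mul1r.
Qed.

Lemma dhomog_prodX (D : {set 'I_n}) :
  (\prod_(k in D) 'X_k : {mpoly C[n]}) \is #|D|.-homog.
Proof.
rewrite -sum1_card; elim/big_ind2: _ => [|p k q l|i _].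
- exact: dhomog1.
- by move=> a b; apply: dhomogM.
- by rewrite dhomogX /= mdeg1.
Qed.

Lemma dhomog_mderiv k f j : f \is k.-homog -> f^`M(j) \is k.-1.-homog.
Proof.
move=> /dhomogP hf; rewrite [f]mpolyE linear_sum /= big_seq.
apply: rpred_sum => m /hf mk; rewrite mderivZ mderivX.
case E: (m j) => [|l]; first by rewrite scale0r scaler0 rpred0.
do 2![apply: rpredZ]; rewrite dhomogX /= -mk.
have := mdegD (m - U_(j)) U_(j); rewrite submK ?mdeg1 ?addn1 => [E2|].
  by apply/eqP; rewrite -[RHS]/(mdeg m).-1 E2.
by apply/mnm_lepP => i; rewrite mnmE; case: eqP => // <-; rewrite E.
Qed.

Lemma dhomog_det (m : nat) (M : 'M[{mpoly C[n]}]_m) (e : 'I_m -> nat) :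
  (forall i j, M i j \is (e i).-homog) ->
  \det M \is (\sum_i e i).-homog.
Proof.
move=> H; apply: rpred_sum => s _; rewrite mulr_sign.
set q := \prod_(i < m) _.
have P : q \is (\sum_i e i).-homog.
  rewrite /q; elim/big_ind2: _ => //; first exact: dhomog1.
  by move=> a k b l ha hb; apply: dhomogM.
by case: ifP => _; rewrite ?dhomogN.
Qed.

End MPolyEval.

(** * Rank and minors with increasing indices *)

Section Minors.
Variable F : fieldType.

Lemma enum_val_homo (m : nat) (T : {set 'I_m}) :
  {homo (@enum_val _ (mem T)) : i j / (i < j)%N}.
Proof.
move=> i j ij; have x0 : 'I_m := enum_val i; rewrite !(enum_val_nth x0).
suff /(sorted_ltn_nth ltn_trans) : sorted ltn [seq val k | k <- enum T].
  move=> /(_ 0%N i j); rewrite !inE !size_map -cardE !ltn_ord => /(_ isT isT ij).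
  by rewrite !(nth_map x0) -?cardE.
rewrite sorted_map; apply: sorted_filter => [x y z|]; first exact: ltn_trans.
by rewrite -enumT -sorted_map val_enum_ord iota_ltn_sorted.
Qed.

(** [maxrankfun] selects independent rows but need not be increasing; enumerating its image as a set
    puts the rows in order. *)
Lemma increasing_row_basis (p q k : nat) (M : 'M[F]_(p, q)) : \rank M = k ->
  exists f : 'I_k -> 'I_p,
    {homo f : i j / (i < j)%N} /\ row_free (rowsub f M).
Proof.
move=> <-; pose f0 := maxrankfun M; pose T := [set f0 i | i in 'I_(\rank M)].
have cT : #|T| = \rank M by rewrite card_imset ?card_ord //; apply: maxrankfun_inj.
suff : exists f : 'I_#|T| -> 'I_p,
    {homo f : i j / (i < j)%N} /\ (\rank (rowsub f M) >= \rank (rowsub f0 M))%N.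
  rewrite eq_maxrowsub cT => -[f [hf rf]]; exists f; split=> //.
  by rewrite -row_leq_rank.
exists (@enum_val _ (mem T)); split; first exact: enum_val_homo.
apply/mxrankS/row_subP => i.
have fT : f0 i \in T by apply: imset_f.
apply: (eq_row_sub (enum_rank_in fT (f0 i))).
by apply/rowP => j; rewrite !mxE enum_rankK_in.
Qed.

Lemma minor_neq0 (p q k : nat) (M : 'M[F]_(p, q)) : \rank M = k ->
  exists (f : 'I_k -> 'I_p) (g : 'I_k -> 'I_q),
     [/\ {homo f : i j / (i < j)%N}, {homo g : i j / (i < j)%N}
       & \det (mxsub f g M) != 0].
Proof.
move=> /increasing_row_basis[f [hf ff]].
have rk : \rank (rowsub f M)^T = k by rewrite mxrank_tr; apply/eqP.
have [g [hg fg]] := increasing_row_basis rk; exists f, g; split=> //.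
rewrite -det_tr -unitfE -unitmxE -row_free_unit.
suff -> : (mxsub f g M)^T = rowsub g (rowsub f M)^T by [].
by apply/matrixP => i j; rewrite !mxE.
Qed.

Lemma minor_eq0 (S : comNzRingType) (p q k : nat) (M : 'M[S]_(p, q))
    (h : {rmorphism S -> F}) (m : S) :
  (\rank (map_mx h M) < k)%N -> minors k M m -> h m = 0.
Proof.
move=> rk [f [g [_ _ ->]]]; rewrite -det_map_mx map_mxsub.
apply/eqP; rewrite -[_ == 0]negbK -unitfE -unitmxE -row_free_unit.
apply: contraL rk; rewrite -leqNgt -row_leq_rank => /leq_trans; apply.
have -> : mxsub f g (map_mx h M) = (rowsub g (rowsub f (map_mx h M))^T)^T.
  by apply/matrixP => i j; rewrite !mxE.
rewrite mxrank_tr; apply: leq_trans (mxrankS (rowsub_sub _ _)) _.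
by rewrite mxrank_tr; apply/mxrankS/rowsub_sub.
Qed.

End Minors.

Lemma col_mul (S : pzSemiRingType) (m n p : nat) (M : 'M[S]_(m, n)) (N : 'M_(n, p)) j :
  col j (M *m N) = M *m col j N.
Proof. by rewrite !colE mulmxA. Qed.

(** * Duality between row space and kernel; flats *)

Section Duality.
Variables (F : fieldType) (d n : nat) (A : 'M[F]_(d, n)).
Implicit Types (S D : {set 'I_n}) (v w x : 'rV[F]_n) (y : 'rV[F]_d).

Definition supported D v := forall j, j \notin D -> v 0 j = 0.

Definition annihilates S y := forall j, j \in S -> (y *m A) 0 j = 0.

(* A flat of the matroid of the columns of A: no circuit meets the complement of
   S in exactly one element. *)
Definition is_flat S := forall v j, v *m A^T = 0 -> j \notin S -> v 0 j != 0 ->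
  exists2 k, k \notin S & (k != j) && (v 0 k != 0).

(** Columns outside of [D] are zeroed rather than deleted, so that the index type stays ['I_n]. *)
Definition mask_cols D : 'M[F]_(d, n) :=
  \matrix_(i, j) (if j \in D then A i j else 0).

Lemma mul_tr_mask D v : supported D v -> v *m (mask_cols D)^T = v *m A^T.
Proof.
move=> sv; apply/rowP => i; rewrite !mxE; apply: eq_bigr => j _.
by rewrite !mxE; case: ifPn => // /sv->; rewrite !mul0r.
Qed.

Lemma mul_mask D y j : (y *m mask_cols D) 0 j = if j \in D then (y *m A) 0 j else 0.
Proof.
rewrite !mxE; case: ifPn => jD; last first.
  by rewrite big1 // => i _; rewrite mxE (negbTE jD) mulr0.
by apply: eq_bigr => i _; rewrite mxE jD.
Qed.

Lemma annihilatesE S y : annihilates S y <-> y *m mask_cols S = 0.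
Proof.
split=> [H|H j jS]; first by apply/rowP => j; rewrite mul_mask [RHS]mxE; case: ifP => // /H.
by have /rowP/(_ j) := H; rewrite mul_mask jS [in X in _ = X -> _]mxE.
Qed.

(** The row space of the masked matrix is cut out by the columns of its cokernel; restricted to [D],
    these are the test vectors [v]. *)
Lemma row_interpolation D x :
  (forall v, v *m A^T = 0 -> supported D v -> \sum_(j in D) x 0 j * v 0 j = 0) ->
  exists y, forall j, j \in D -> (y *m A) 0 j = x 0 j.
Proof.
move=> H; pose M := mask_cols D.
pose x' : 'rV_n := \row_j (if j \in D then x 0 j else 0).
have /submxP[y yE] : (x' <= M)%MS.
  rewrite submxE; apply/eqP/rowP => c; rewrite [RHS]mxE.
  pose v : 'rV_n := \row_j (if j \in D then cokermx M j c else 0).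
  have sv : supported D v by move=> j /negbTE jD; rewrite mxE jD.
  have kv : v *m A^T = 0.
    apply/rowP => i; rewrite [RHS]mxE.
    have /matrixP/(_ i c) := mulmx_coker M; rewrite [RHS]mxE => <-.
    rewrite !mxE; apply: eq_bigr => j _; rewrite !mxE.
    by case: ifP; rewrite ?mulr0 ?mul0r // mulrC.
  rewrite -[RHS](H v kv sv) mxE [RHS]big_mkcond; apply: eq_bigr => j _.
  by rewrite !mxE; case: ifP => //; rewrite mul0r.
exists y => j jD; have /rowP/(_ j) := yE.
by rewrite mul_mask jD [LHS]mxE jD => ->.
Qed.

Lemma column_interpolation S (g : 'cV[F]_d) :
  (forall y, annihilates S y -> y *m g = 0) ->
  exists w, supported S w /\ w *m A^T = g^T.
Proof.
move=> H; pose M := mask_cols S.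
have /submxP[w wE] : (g^T <= M^T)%MS.
  rewrite submxE; apply/eqP/rowP => c; rewrite [RHS]mxE.
  pose y : 'rV_d := (col c (cokermx M^T))^T.
  have /H yg : annihilates S y.
    apply/annihilatesE; rewrite -[mask_cols S]trmxK -trmx_mul -col_mul.
    by rewrite mulmx_coker; apply/rowP => j; rewrite !mxE.
  have <- : (y *m g) 0 0 = 0 by rewrite yg mxE.
  by rewrite !mxE; apply: eq_bigr => i _; rewrite !mxE mulrC.
pose w' : 'rV_n := \row_j (if j \in S then w 0 j else 0).
have sw : supported S w' by move=> j /negbTE jS; rewrite mxE jS.
exists w'; split=> //; rewrite -(mul_tr_mask sw) wE.
apply/rowP => i; rewrite !mxE; apply: eq_bigr => j _.
by rewrite !mxE; case: ifP => // _; rewrite ?mulr0 ?mul0r.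
Qed.

Lemma mul_delta_col j i : (delta_mx 0 j *m A^T : 'rV_d) 0 i = A i j.
Proof.
rewrite mxE (bigD1 j) //= big1 ?addr0 => [|k kj].
  by rewrite !mxE !eqxx mul1r.
by rewrite !mxE (negbTE kj) andbF mul0r.
Qed.

(** Otherwise column [j] is a combination [w] of the columns in [S], and [w - delta_mx 0 j] is a
    kernel vector that meets the complement of [S] in [j] alone. *)
Lemma flat_separation S j : is_flat S -> j \notin S ->
  exists2 y, annihilates S y & (y *m A) 0 j != 0.
Proof.
move=> fS jS; pose K := kermx (mask_cols S).
have [/existsP[i Hi]|] := boolP [exists i, (row i K *m A) 0 j != 0].
  exists (row i K) => //; apply/annihilatesE.
  by rewrite -row_mul mulmx_ker row0.
rewrite negb_exists => /forallP H.
have [|w [sw wE]] := @column_interpolation S (col j A).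
  move=> y /annihilatesE/sub_kermxP/submxP[z ->].
  apply/matrixP => a b; rewrite !ord1 -mulmxA [RHS]mxE mxE big1 // => i _.
  have /negPn/eqP := H i; rewrite -row_mul mxE -col_mul [in X in _ * X]mxE => ->.
  by rewrite mulr0.
have kv : (w - delta_mx 0 j) *m A^T = 0.
  rewrite mulmxBl wE; apply/rowP => i; rewrite !(mul_delta_col, mxE) subrr //.
have /fS/(_ jS)[] := kv.
  by rewrite !mxE !eqxx (sw _ jS) sub0r oppr_eq0 oner_eq0.
move=> k kS /andP[kj].
by rewrite !mxE eqxx (negbTE kj) (sw _ kS) subr0 eqxx.
Qed.

End Duality.

(** * Generic real lines in the annihilator of a flat *)

Section GenericLine.
Variables (C : numClosedFieldType) (d n : nat) (A : 'M[C]_(d, n)).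
Hypothesis realA : map_mx Num.conj A = A.
Implicit Types (S D : {set 'I_n}) (v w x : 'rV[C]_n) (y e f : 'rV[C]_d).

Definition real_row m (x : 'rV[C]_m) := map_mx Num.conj x = x.

Lemma real_coord y j : real_row y -> (y *m A) 0 j \is Num.real.
Proof.
by move=> ry; rewrite CrealE -{2}realA -{2}ry -map_mxM [X in _ == X]mxE.
Qed.

(** The kernel matrix of a real matrix is real, and the generic combination of its rows has natural
    coefficients. *)
Lemma real_generic (I : finType) (P : pred I) (g : I -> 'cV[C]_d) S :
  (forall i, P i -> exists2 y, annihilates A S y & y *m g i != 0) ->
  exists y, [/\ real_row y, annihilates A S y &
    forall i, P i -> (y *m g i) 0 0 != 0].
Proof.
move=> H; pose K := kermx (mask_cols A S).
have [|k Hk] := @generic_combination C _ _ I P K g.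
  move=> i /H[y /annihilatesE/sub_kermxP/submxP[z ->]].
  by apply: contraNneq => E; rewrite -mulmxA -/K E mulmx0.
exists ((\row_(j < d) k%:R ^+ j) *m K); split=> //.
  rewrite /real_row map_mxM map_kermx; congr mulmx.
    by apply/rowP => j; rewrite !mxE rmorphXn /= rmorph_nat.
  congr kermx; apply/matrixP => i j; rewrite !mxE; case: ifP => _; rewrite ?rmorph0 //.
  by have /matrixP/(_ i j) := realA; rewrite mxE.
by apply/annihilatesE; rewrite -mulmxA mulmx_ker mulmx0.
Qed.

(* The linear forms y |-> (y A)_j, j outside of S, restricted to the line
   through e in direction f, are equal up to scalars only if they already are
   so on the whole space of the y annihilating S. *)
Definition generic_line S e f := [/\ real_row e /\ real_row f,
  annihilates A S e, annihilates A S f,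
  forall j, j \notin S -> (f *m A) 0 j != 0 &
  forall a b, a \notin S -> b \notin S ->
    (e *m A) 0 a * (f *m A) 0 b = (e *m A) 0 b * (f *m A) 0 a ->
    forall y, annihilates A S y ->
      (y *m A) 0 a * (f *m A) 0 b = (y *m A) 0 b * (f *m A) 0 a].

Lemma mulmx_col y j : (y *m col j A) 0 0 = (y *m A) 0 j.
Proof. by rewrite -col_mul mxE. Qed.

Lemma exists_generic_line S : is_flat A S -> exists e f, generic_line S e f.
Proof.
move=> fS.
have [|f [rf Sf f0]] := @real_generic _ (fun j => j \notin S) (fun j => col j A) S.
  move=> j /(flat_separation fS)[y Sy yj]; exists y => //.
  by apply: contraNneq yj => E; rewrite -mulmx_col E mxE.
(* Pairing [y] with [g (a, b)] gives the 2 x 2 determinant of the forms of columns a and b at [y]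
   and [f]. The vector [e] avoids the zeros of each such determinant that is not identically 0 on
   the annihilators of [S]. *)
pose g (ab : 'I_n * 'I_n) := (f *m A) 0 ab.2 *: col ab.1 A - (f *m A) 0 ab.1 *: col ab.2 A.
have gE y ab : (y *m g ab) 0 0 = (y *m A) 0 ab.1 * (f *m A) 0 ab.2 -
    (y *m A) 0 ab.2 * (f *m A) 0 ab.1.
  by rewrite mulmxBr -!scalemxAr -!col_mul !mxE mulrC; congr (_ - _); rewrite mulrC.
pose K := kermx (mask_cols A S).
have [|e [re Se e0]] := @real_generic _ (fun ab => K *m g ab != 0) g S.
  move=> ab /rowV0Pn[y /submxP[z yE] y0].
  exists (z *m K); last by rewrite -mulmxA -yE.
  by apply/annihilatesE; rewrite -mulmxA mulmx_ker mulmx0.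
exists e, f; split=> // [j /f0|a b aS bS /eqP]; first by rewrite mulmx_col.
rewrite -subr_eq0 -(gE e (a, b)) => Eab y /annihilatesE/sub_kermxP/submxP[z yE].
apply/eqP; rewrite -subr_eq0 -(gE y (a, b)) yE -mulmxA -/K.
have [->|/e0] := eqVneq (K *m g (a, b)) 0; first by rewrite mulmx0 mxE.
by rewrite Eab.
Qed.

End GenericLine.

(** After exchanging the sums, each [x k] receives weight 1/m from each of the m members of its
    class, and [h] is constant on that class. *)
Lemma class_average (F : numFieldType) (I : finType) (T : eqType) (P : pred I)
    (tau : I -> T) (h x : I -> F) :
  (forall j k, P j -> P k -> tau j = tau k -> h j = h k) ->
  \sum_(j | P j) h j * ((\sum_(k | P k && (tau k == tau j)) x k) /
    (\sum_(k | P k && (tau k == tau j)) 1)) = \sum_(j | P j) h j * x j.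
Proof.
move=> hc; pose m j : F := \sum_(k | P k && (tau k == tau j)) 1.
have m0 j : P j -> m j != 0.
  move=> Pj; rewrite /m sumr_const pnatr_eq0 -lt0n; apply/card_gt0P; exists j.
  by rewrite unfold_in /= Pj eqxx.
under eq_bigr => j _ do rewrite mulr_suml mulr_sumr.
rewrite (exchange_big_dep P) /=; last by move=> j k _ /andP[].
apply: eq_bigr => k Pk.
rewrite (eq_bigr (fun=> h k * x k * (m k)^-1 * 1)).
  rewrite -mulr_sumr -[X in _ * X]/(\sum_(i | _) 1).
  rewrite (_ : \sum_(i | _) 1 = m k) ?mulfVK ?m0 //.
  by apply: eq_bigl => j; rewrite Pk /= eq_sym.
move=> j /andP[Pj /= /andP[_ /eqP kj]]; rewrite (hc _ _ Pj Pk) // mulr1 mulrA.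
by rewrite /m (eq_bigl (fun k0 => P k0 && (tau k0 == tau k))) // => i; rewrite kj.
Qed.

(** * Pairing the row space with the kernel *)

Section Pairing.
Variables (F : fieldType) (d n : nat) (A : 'M[F]_(d, n)).
Implicit Types (v w : 'rV[F]_n) (y : 'rV[F]_d).

Lemma pairingE y w : \sum_j (y *m A) 0 j * w 0 j = (y *m (w *m A^T)^T) 0 0.
Proof.
rewrite trmx_mul trmxK mulmxA [RHS]mxE; apply: eq_bigr => j _.
by rewrite [w^T _ _]mxE.
Qed.

Lemma pairing0 y w : w *m A^T = 0 -> \sum_j (y *m A) 0 j * w 0 j = 0.
Proof. by rewrite pairingE => ->; rewrite trmx0 mulmx0 mxE. Qed.

Lemma pairing_eq0 w :
  (forall y, \sum_j (y *m A) 0 j * w 0 j = 0) -> w *m A^T = 0.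
Proof.
move=> H; apply: trmx_inj; rewrite trmx0; apply/row_matrixP => i; rewrite row0 rowE.
by apply/rowP => c; rewrite ord1 -pairingE H mxE.
Qed.

Lemma annihilates_lin S y (a : F) z : annihilates A S y -> annihilates A S z ->
  annihilates A S (y + a *: z).
Proof.
move=> Sy Sz j jS; rewrite mulmxDl -scalemxAl mxE (Sy j jS).
by rewrite mxE (Sz j jS) mulr0 addr0.
Qed.

End Pairing.

(** * The tangent space at a point with support S *)

Section Tangent.
Variables (C : numClosedFieldType) (d n : nat) (A : 'M[C]_(d, n)).
Hypothesis realA : map_mx Num.conj A = A.
Variable S : {set 'I_n}.
Hypothesis flatS : is_flat A S.
Implicit Types (v w x g p : 'rV[C]_n) (y z e f : 'rV[C]_d).

(* This describes the Zariski tangent space at p to the cone over the reciprocal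
   plane, when S is the support of p. *)
Definition tangent p w :=
  (forall v, v *m A^T = 0 -> supported S v ->
     \sum_(j in S) v 0 j * w 0 j / p 0 j ^+ 2 = 0) /\
  (forall a b v, a \notin S -> b \notin S -> a != b -> v *m A^T = 0 ->
     supported (a |: (b |: S)) v -> v 0 b * w 0 a + v 0 a * w 0 b = 0).

(** On the line [e + t *: f] the form of column [j] vanishes at t = - slope. For a generic line,
    columns outside of [S] with equal slopes are parallel modulo the span of the columns in [S]. *)
Definition slope e f j := (e *m A) 0 j / (f *m A) 0 j.

Lemma slope_eq e f a b : generic_line A S e f -> a \notin S -> b \notin S ->
  slope e f a = slope e f b ->
  (e *m A) 0 a * (f *m A) 0 b = (e *m A) 0 b * (f *m A) 0 a.
Proof.
move=> [_ _ _ f0 _] aS bS /eqP; rewrite /slope eqr_div ?f0 // => /eqP->.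
by rewrite mulrC.
Qed.

(** Genericity turns equal slopes into proportionality of the two forms on all annihilators of [S],
    so a combination of columns [a] and [b] lies in the span of the columns in [S]. *)
Lemma parallel_vector e f a b : generic_line A S e f ->
  a \notin S -> b \notin S -> a != b -> slope e f a = slope e f b ->
  exists v, [/\ v *m A^T = 0, supported (a |: (b |: S)) v,
    v 0 a = (f *m A) 0 b & v 0 b = - (f *m A) 0 a].
Proof.
move=> gl aS bS ab sab; have eab := slope_eq gl aS bS sab.
have [_ _ _ _ /(_ a b aS bS eab) par] := gl.
pose c := (f *m A) 0 b; pose c' := (f *m A) 0 a.
have [|w [sw wE]] := @column_interpolation _ _ _ A S (c *: col a A - c' *: col b A).
  move=> y /par E; apply/matrixP => i j; rewrite !ord1 mulmxBr -!scalemxAr -!col_mul.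
  transitivity (c * (y *m A) 0 a - c' * (y *m A) 0 b); first by rewrite !mxE.
  by rewrite mulrC E mulrC subrr mxE.
exists (c *: delta_mx 0 a - c' *: delta_mx 0 b - w); split.
- have dE j : delta_mx 0 j *m A^T = (col j A)^T.
    by apply/rowP => i; rewrite mul_delta_col !mxE.
  by rewrite !mulmxBl wE -!scalemxAl !dE linearB /= !linearZ subrr.
- move=> j; rewrite !inE !negb_or => /and3P[ja jb jS].
  by rewrite !mxE (negbTE ja) (negbTE jb) (sw _ jS) !andbF !mulr0 !subr0.
- by rewrite -/c !mxE !eqxx (negbTE ab) (sw _ aS) !andbF mulr0 mulr1 !subr0.
- by rewrite -/c' !mxE !eqxx eq_sym (negbTE ab) (sw _ bS) mulr0 mulr1 sub0r subr0.
Qed.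

Lemma tangent_slope p w e f a b : generic_line A S e f -> tangent p w ->
  a \notin S -> b \notin S -> slope e f a = slope e f b ->
  (f *m A) 0 a * w 0 a = (f *m A) 0 b * w 0 b.
Proof.
move=> gl [_ tw] aS bS sab; have [->//|ab] := eqVneq a b.
have [v [kv sv va vb]] := parallel_vector gl aS bS ab sab.
have := tw _ _ _ aS bS ab kv sv; rewrite va vb mulNr addrC => /subr0_eq.
by move->.
Qed.

(** The directions - p^2 (z A) on [S] and 1/(y A) outside of [S] are the velocities at [p] of curves
    in the reciprocal plane. That they span the tangent space is put dually, through a functional
    [g] vanishing on them. *)
Lemma tangent_spanned p g w : (forall j, j \in S -> p 0 j != 0) ->
  (forall z y, annihilates A S y -> (forall j, j \notin S -> (y *m A) 0 j != 0) ->
    \sum_(j in S) g 0 j * (- p 0 j ^+ 2 * (z *m A) 0 j) +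
    \sum_(j | j \notin S) g 0 j / (y *m A) 0 j = 0) ->
  tangent p w -> \sum_j g 0 j * w 0 j = 0.
Proof.
move=> p0 Hg tw; have [e [f gl]] := exists_generic_line realA flatS.
have [_ Se Sf f0 _] := gl.
have Hz z : \sum_(j in S) g 0 j * (- p 0 j ^+ 2 * (z *m A) 0 j) = 0.
  have := Hg z f Sf f0; have := Hg 0 f Sf f0.
  rewrite big1 ?add0r => [->|j _]; last by rewrite mul0mx mxE !mulr0.
  by rewrite addr0.
have Hy y : annihilates A S y -> (forall j, j \notin S -> (y *m A) 0 j != 0) ->
    \sum_(j | j \notin S) g 0 j / (y *m A) 0 j = 0.
  by move=> Sy y0; have := Hg 0 y Sy y0; rewrite Hz add0r.
(* By the first tangency condition, w / p^2 agrees on [S] with a vector of the row space. *)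
have HS : \sum_(j in S) g 0 j * w 0 j = 0.
  have [v kv sv|z zE] := @row_interpolation _ _ _ A S (\row_j (w 0 j / p 0 j ^+ 2)).
    rewrite -[RHS](proj1 tw v kv sv); apply: eq_bigr => j _; rewrite mxE.
    by rewrite mulrC mulrA.
  transitivity (- (\sum_(j in S) g 0 j * (- p 0 j ^+ 2 * (z *m A) 0 j))).
    rewrite -sumrN.
  apply: eq_bigr => j jS; rewrite zE // mxE mulNr mulrN opprK.
  by rewrite [X in _ = _ * X]mulrC divfK // sqrf_eq0 p0.
  by rewrite Hz oppr0.
have HZ : \sum_(j | j \notin S) g 0 j * w 0 j = 0.
  pose l j := (f *m A) 0 j; pose tau := slope e f.
  (* Partial fractions: on the line, the sum of (g_j / l_j) / (t + tau_j) is 0. [D] is the product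
     of the denominators with slopes other than tau_a; multiplying by it and by t + tau_a and
     setting t = - tau_a isolates the residue [c] of the class of [a]. *)
  have Hc a : a \notin S ->
      \sum_(j | (j \notin S) && (tau j == tau a)) g 0 j / l j = 0.
    move=> aS; pose Q j := (j \notin S) && (tau j != tau a).
    pose D := \prod_(k | Q k) ('X + (tau k)%:P).
    pose E := \sum_(j | Q j) (g 0 j / l j) *: \prod_(k | Q k && (k != j)) ('X + (tau k)%:P).
    pose c := \sum_(j | (j \notin S) && (tau j == tau a)) g 0 j / l j.
    have q0 : c *: D + ('X + (tau a)%:P) * E = 0.
      pose B := \prod_(k | k \notin S) ('X + (tau k)%:P).
      apply: (@poly_eq0_cofinite _ _ B).
        by apply/prodf_neq0 => k _; rewrite -size_poly_eq0 size_XaddC.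
      move=> t; rewrite horner_prod_neq0 => /forall_inP Bt.
      have lt j : j \notin S -> ((e + t *: f) *m A) 0 j = l j * (t + tau j).
        move=> jS; rewrite mulmxDl -scalemxAl mxE [in X in _ + X]mxE.
        by rewrite /l /tau /slope mulrDr mulrCA divff ?f0 // mulr1 addrC mulrC.
      have tk k : k \notin S -> t + tau k != 0.
        by move/Bt; rewrite hornerD hornerX hornerC.
      have Ht : \sum_(j | j \notin S) g 0 j / l j / (t + tau j) = 0.
        rewrite -[RHS](Hy (e + t *: f) (annihilates_lin t Se Sf)).
          by apply: eq_bigr => j jS; rewrite lt // invfM mulrA.
        by move=> j jS; rewrite lt // mulf_neq0 ?tk // f0.
      rewrite (bigID (fun j => tau j == tau a)) /= in Ht.
      rewrite (eq_bigr (fun j => g 0 j / l j * (t + tau a)^-1)) in Ht; last first.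
        by move=> j /andP[_ /eqP->].
      rewrite -mulr_suml -/c in Ht.
      have ED : E.[t] = D.[t] * \sum_(j | Q j) g 0 j / l j / (t + tau j).
        rewrite /E horner_sum mulr_sumr; apply: eq_bigr => j Qj.
        have -> : D = ('X + (tau j)%:P) * \prod_(k | Q k && (k != j)) ('X + (tau k)%:P).
          by rewrite /D (bigD1 j).
        have tj : t + tau j != 0 by apply: tk; case/andP: Qj.
        by rewrite hornerZ hornerM hornerD hornerX hornerC; field; rewrite tj f0 //; case/andP: Qj.
      rewrite hornerD hornerZ hornerM ED hornerD hornerX hornerC.
      have tka := tk a aS; move: Ht; set u := \sum_(j | Q j) _ => Ht.
      have {}Ht : c + (t + tau a) * u = 0.
        by rewrite -[RHS](mulr0 (t + tau a)) -Ht; field.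
      by transitivity (D.[t] * (c + (t + tau a) * u)); [ring | rewrite Ht mulr0].
    have /(congr1 (fun q => q.[- tau a])) := q0.
    rewrite hornerD hornerM hornerZ hornerD hornerX hornerC addNr mul0r addr0.
    rewrite horner0 => /eqP; rewrite mulf_eq0 -/c => /orP[/eqP//|].
    rewrite -[_ == 0]negbK horner_prod_neq0 => /negP[].
    apply/forall_inP => k /andP[kS ka].
    by rewrite hornerD hornerX hornerC addrC subr_eq0.
  (* By [tangent_slope], [l j * w 0 j] is constant on classes, so only the class sums of
     [g 0 j / l j] enter, and they are 0. *)
  rewrite (eq_bigr (fun j => (l j * w 0 j) * (g 0 j / l j))); last first.
    by move=> j jS; have l0 : l j != 0 := f0 j jS; field.
  rewrite -(class_average (tau := tau)); last first.
    by move=> j k jS kS; apply: tangent_slope tw _ _.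
  by apply: big1 => j jS; rewrite Hc // mul0r mulr0.
by rewrite (bigID (mem S)) /= HS HZ addr0.
Qed.

End Tangent.

(** * Nondegeneracy at real points by positivity *)

Section RealTangent.
Variables (C : numClosedFieldType) (d n : nat) (A : 'M[C]_(d, n)).
Hypothesis realA : map_mx Num.conj A = A.
Hypothesis freeA : row_free A.
Variable S : {set 'I_n}.
Hypothesis flatS : is_flat A S.
Implicit Types (v w x g p : 'rV[C]_n) (y z e f : 'rV[C]_d).

Lemma conj_pairing y j : (map_mx Num.conj y *m A) 0 j = ((y *m A) 0 j)^*.
Proof. by rewrite -{1}realA -map_mxM [LHS]mxE. Qed.

Lemma sum_normC_eq0 (I : finType) (P : pred I) (c u : I -> C) :
  (forall j, P j -> c j \is Num.real) ->
  \sum_(j | P j) c j ^+ 2 * (u j * (u j)^*) = 0 ->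
  forall j, P j -> c j * u j = 0.
Proof.
move=> cR H j Pj; apply/eqP; rewrite -normr_eq0 -sqrf_eq0 normrM exprMn.
rewrite real_normK ?cR // normCK; move: j Pj; apply/forall_inP.
suff : \sum_(j | P j) c j ^+ 2 * (u j * (u j)^*) == 0.
  rewrite psumr_eq0 ?big_all // => [/allP K|j Pj].
    by apply/forall_inP => j Pj; have := K j (mem_index_enum j); rewrite Pj.
  by rewrite mulr_ge0 ?mul_conjC_ge0 ?real_exprn_even_ge0 ?cR.
by rewrite H.
Qed.

Lemma mulmxA_eq0 y : (forall j, (y *m A) 0 j = 0) -> y = 0.
Proof.
move=> H; apply/eqP; rewrite -(mulmx_free_eq0 _ freeA); apply/eqP/rowP => j.
by rewrite H mxE.
Qed.

Lemma pairing_supported D y v : v *m A^T = 0 -> supported D v ->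
  \sum_(j in D) (y *m A) 0 j * v 0 j = 0.
Proof.
move=> kv sv; rewrite -[RHS](pairing0 y kv) [RHS](bigID (mem D)) /=.
by rewrite [X in _ = _ + X]big1 ?addr0 // => j /sv->; rewrite mulr0.
Qed.

Lemma tangent_nondegenerate p (c : C) x y :
  (forall j, (j \in S) = (p 0 j != 0)) ->
  c != 0 -> real_row x -> p = c *: x ->
  (forall w, tangent A S p w -> \sum_j (y *m A) 0 j * w 0 j = 0) -> y = 0.
Proof.
move=> pS c0 rx pE H; pose z j := (y *m A) 0 j.
have zS j : j \in S -> z j = 0.
  (* Divided by p^2, this vector is conj(y) A on [S], so it is tangent. As p = c x with x real, its
     pairing with [z] is c^2 times a sum of squares |x_j z_j|^2. *)
  pose w : 'rV_n := \row_j (if j \in S then (z j)^* * p 0 j ^+ 2 else 0).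
  have tw : tangent A S p w.
    split=> [v kv sv|a b v aS bS _ _ _]; last first.
      by rewrite !mxE (negbTE aS) (negbTE bS) !mulr0 addr0.
    rewrite -[RHS](pairing_supported (map_mx Num.conj y) kv sv).
    apply: eq_bigr => i iS; rewrite [w _ _]mxE iS conj_pairing -/(z i).
    by rewrite mulrA mulfK ?sqrf_eq0 -?pS // mulrC.
  have := H w tw; rewrite (bigID (mem S)) /= [X in _ + X]big1 ?addr0; last first.
    by move=> i iS; rewrite [w _ _]mxE (negbTE iS) mulr0.
  rewrite (eq_bigr (fun j => c ^+ 2 * (x 0 j ^+ 2 * (z j * (z j)^*)))); last first.
    by move=> i iS; rewrite [w _ _]mxE iS pE [(c *: x) _ _]mxE -/(z i); ring.
  rewrite -mulr_sumr => /eqP; rewrite mulf_eq0 sqrf_eq0 (negbTE c0) /= => /eqP.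
  have xr k : k \in S -> x 0 k \is Num.real.
    by move=> _; rewrite CrealE; have /rowP/(_ k) := rx; rewrite mxE => ->.
  move=> /(sum_normC_eq0 xr) K jS; have /eqP := K j jS.
  rewrite mulf_eq0 => /orP[/eqP xj|/eqP//].
  by move: jS; rewrite pS pE mxE xj mulr0 eqxx.
have flat0 a b v : b \notin S -> v *m A^T = 0 -> supported (a |: (b |: S)) v ->
    v 0 a = 0 -> v 0 b = 0.
  move=> bS kv sv va; apply/eqP/negPn/negP => vb.
  have [k kS /andP[kb /eqP]] := flatS kv bS vb; apply.
  have [->//|ka] := eqVneq k a.
  by apply: sv; rewrite !inE !negb_or ka kb.
have zZ j : j \notin S -> z j = 0.
  (* As 0^-1 is 0, the pairing of this vector with [z] counts the nonzero z_j outside of [S]. Its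
     tangency is z_a v_a + z_b v_b = 0 divided by z_a z_b; if exactly one of z_a, z_b is 0, flatness
     gives v_a = v_b = 0. *)
  pose w : 'rV_n := \row_j (if j \in S then 0 else (z j)^-1).
  have tw : tangent A S p w.
    split=> [v kv sv|a b v aS bS ab kv sv].
      by rewrite big1 // => j' j'S; rewrite mxE j'S mulr0 mul0r.
    have := pairing_supported y kv sv.
    rewrite big_setU1 /= ?inE ?negb_or ?ab ?aS //.
    rewrite big_setU1 //= big1 ?addr0 => [|k /zS]; last first.
      by rewrite /z => ->; rewrite mul0r.
    rewrite -/(z a) -/(z b) !mxE (negbTE aS) (negbTE bS).
    have [->|za] := eqVneq (z a) 0; have [->|zb] := eqVneq (z b) 0.
    - by rewrite invr0 !mulr0 addr0.
    - rewrite mul0r add0r => /eqP; rewrite mulf_eq0 (negbTE zb) /= => /eqP vb.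
      have sv' : supported (b |: (a |: S)) v by rewrite finset.setUCA.
      by rewrite vb (flat0 b a) ?mul0r ?addr0.
    - rewrite mul0r addr0 => /eqP; rewrite mulf_eq0 (negbTE za) /= => /eqP va.
      by rewrite va (flat0 a b) ?mul0r ?addr0.
    - move=> E; transitivity ((z a * v 0 a + z b * v 0 b) / (z a * z b)).
        by field; rewrite za zb.
      by rewrite E mul0r.
  have := H w tw; rewrite (bigID (mem S)) /= big1 ?add0r; last first.
    by move=> k kS; rewrite [w _ _]mxE kS mulr0.
  rewrite (eq_bigr (fun j => (z j != 0)%:R)); last first.
    move=> k kS; rewrite [w _ _]mxE (negbTE kS) -/(z k); case: eqVneq => [->|zk].
      by rewrite mul0r.
    by rewrite divff.
  move=> /eqP; rewrite psumr_eq0 => [/allP K jS|k _]; last by rewrite ler0n.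
  have := K j (mem_index_enum j); rewrite jS /= pnatr_eq0 eqb0 negbK.
  by move/eqP.
apply: mulmxA_eq0 => j; case: (boolP (j \in S)); [exact: zS | exact: zZ].
Qed.

End RealTangent.

(** * The Hermitian form on class vectors and a root of its determinant *)

Section NonrealRoot.
Variables (C : numClosedFieldType) (d n : nat) (A : 'M[C]_(d, n)).
Hypothesis realA : map_mx Num.conj A = A.
Hypothesis freeA : row_free A.
Variable S : {set 'I_n}.
Variables (e f : 'rV[C]_d).
Hypothesis gl : generic_line A S e f.
Implicit Types (v w x g p : 'rV[C]_n) (y z : 'rV[C]_d).

Let le j := (e *m A) 0 j.
Let lf j := (f *m A) 0 j.
Let tau := slope A e f.

(** These vectors vanishing on [S] are supplied by singular points. The last condition comes from
    [tangent_slope] and leaves one number per class of parallel columns. *)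
Definition class_vector w := [/\ supported (~: S) w,
  forall y, annihilates A S y -> \sum_j (y *m A) 0 j * w 0 j = 0 &
  forall a b, a \notin S -> b \notin S -> tau a = tau b -> lf a * w 0 a = lf b * w 0 b].

Lemma common_kernel (I : finType) (c : I -> 'cV[C]_n) :
  exists N : 'M[C]_n, forall w, (w <= N)%MS <-> (forall i, w *m c i = 0).
Proof.
exists (\bigcap_i kermx (c i))%MS => w; split=> [/sub_bigcapmxP H i|H].
  by apply/sub_kermxP/H.
by apply/sub_bigcapmxP => i _; apply/sub_kermxP.
Qed.

Lemma class_vector_space :
  exists N : 'M[C]_n, forall w, (w <= N)%MS <-> class_vector w.
Proof.
pose K := kermx (mask_cols A S).
pose c (i : 'I_n + 'I_d + 'I_n * 'I_n) : 'cV[C]_n :=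
  match i with
  | inl (inl j) => if j \in S then delta_mx j 0 else 0
  | inl (inr i) => (row i (K *m A))^T
  | inr (a, b) => if [&& a \notin S, b \notin S & tau a == tau b]
                  then lf a *: delta_mx a 0 - lf b *: delta_mx b 0 else 0
  end.
have wd w j : (w *m (delta_mx j 0 : 'cV_n)) = (w 0 j)%:M.
  by rewrite -colE; apply/matrixP => a b; rewrite !ord1 !mxE eqxx.
have [N NP] := common_kernel c; exists N => w; rewrite NP.
split=> [H|[sw yw pw] [[j|i]|[a b]]].
- split=> [j|y /annihilatesE/sub_kermxP/submxP[z ->]|a b aS bS ab].
  + rewrite inE negbK => jS; have := H (inl (inl j)); rewrite /= jS wd.
    by move/matrixP/(_ 0 0); rewrite !mxE eqxx.
  + have E : K *m A *m w^T = 0.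
      apply/row_matrixP => i; rewrite row0 row_mul.
      have E := congr1 trmx (H (inl (inr i))).
      by rewrite /= trmx0 trmx_mul trmxK in E.
    have -> : \sum_j (z *m K *m A) 0 j * w 0 j = (z *m K *m A *m w^T) 0 0.
      by rewrite [RHS]mxE; apply: eq_bigr => j _; rewrite [w^T _ _]mxE.
    have -> : z *m K *m A *m w^T = z *m (K *m A *m w^T) by rewrite !mulmxA.
    by rewrite E mulmx0 mxE.
  + have := H (inr (a, b)); rewrite /= aS bS ab eqxx /= mulmxBr -!scalemxAr !wd.
    by move/matrixP/(_ 0 0); rewrite !mxE eqxx /= !mulr1n => /subr0_eq.
- rewrite /=; case: ifP => [jS|_]; last by rewrite mulmx0.
  by rewrite wd sw ?inE ?jS // raddf0.
- rewrite /=; apply/matrixP => a b; rewrite !ord1 [RHS]mxE.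
  have Sy : annihilates A S (row i K).
    by apply/annihilatesE; rewrite -row_mul mulmx_ker row0.
  rewrite -[RHS](yw _ Sy) mxE; apply: eq_bigr => j _; rewrite -[in RHS]row_mul.
  by rewrite [_^T _ _]mxE mulrC.
- rewrite /=; case: and3P => [[aS bS /eqP ab]|_]; last by rewrite mulmx0.
  by rewrite mulmxBr -!scalemxAr !wd !scale_scalar_mx (pw a b) // subrr.
Qed.

Lemma class_vector_conj w : class_vector w -> class_vector (map_mx Num.conj w).
Proof.
move=> [sw yw pw]; have [[re rf] _ _ _ _] := gl.
split=> [j /sw|y Sy|a b aS bS ab].
- by rewrite mxE => ->; rewrite rmorph0.
- have Sy' : annihilates A S (map_mx Num.conj y).
    by move=> j /Sy; rewrite conj_pairing // => ->; rewrite rmorph0.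
  apply: (inv_inj conjCK); rewrite rmorph0 -[RHS](yw _ Sy') rmorph_sum.
  by apply: eq_bigr => j _; rewrite rmorphM conj_pairing // [map_mx _ w _ _]mxE /= conjCK.
- have lfR j : (lf j)^* = lf j by apply/CrealP/real_coord.
  have := congr1 Num.conj (pw a b aS bS ab).
  by rewrite !rmorphM /= !lfR ![map_mx _ w _ _]mxE.
Qed.

(* The vector w is obtained from v by averaging over the classes of columns that
   are parallel modulo the span of the columns in S. *)
Lemma class_vector_average v : v *m A^T = 0 ->
  exists2 w, class_vector w &
    forall h : 'I_n -> C,
      (forall a b, a \notin S -> b \notin S -> tau a = tau b -> h a / lf a = h b / lf b) ->
      \sum_(j | j \notin S) h j * w 0 j = \sum_(j | j \notin S) h j * v 0 j.
Proof.
move=> kv; have [_ Se Sf f0 par] := gl.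
pose av j := (\sum_(k | (k \notin S) && (tau k == tau j)) lf k * v 0 k) /
    (\sum_(k | (k \notin S) && (tau k == tau j)) 1).
pose w : 'rV[C]_n := \row_j (if j \in S then 0 else av j / lf j).
have wE (h : 'I_n -> C) :
    (forall a b, a \notin S -> b \notin S -> tau a = tau b -> h a / lf a = h b / lf b) ->
      \sum_(j | j \notin S) h j * w 0 j = \sum_(j | j \notin S) h j * v 0 j.
  move=> hc; transitivity (\sum_(j | j \notin S) h j / lf j * av j).
    by apply: eq_bigr => j jS; rewrite mxE (negbTE jS) mulrCA mulrC.
  rewrite (class_average (tau := tau)) //; apply: eq_bigr => j jS.
  have l0 : lf j != 0 := f0 j jS; by field.
exists w => //; split=> [j|y Sy|a b aS bS ab].
- by rewrite inE negbK mxE => ->.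
- have -> : \sum_j (y *m A) 0 j * w 0 j = \sum_(j | j \notin S) (y *m A) 0 j * w 0 j.
    rewrite (bigID (mem S)) /= big1 ?add0r // => j jS.
    by rewrite [w _ _]mxE jS mulr0.
  rewrite wE => [|a b aS bS /(slope_eq gl aS bS)/(par a b aS bS)/(_ y Sy) E].
    rewrite -[RHS](pairing0 y kv) [RHS](bigID (mem S)) /=.
    by rewrite [X in _ = X + _]big1 ?add0r // => j /Sy->; rewrite mul0r.
  by apply/eqP; rewrite eqr_div ?f0 // E.
- rewrite !mxE (negbTE aS) (negbTE bS) -!/(lf _) ![lf _ * _]mulrC !divfK ?f0 //.
  by rewrite /av ab.
Qed.

(** Adding the d equations A D w = 0 to J w = 0 still leaves a solution w != 0, and its part outside
    of [S] is taken. If that part were 0, D w would be a kernel vector supported on [S] and agreeing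
    there with a vector of the row space, hence 0 by positivity. *)
Lemma class_vector_exists m (J : 'M[C]_(m, n)) p :
  (forall j, (j \in S) = (p 0 j != 0)) -> (\rank J + d < n)%N ->
  (forall w, J *m w^T = 0 -> tangent A S p w) ->
  exists2 w, w != 0 & class_vector w.
Proof.
move=> pS rJ Jt; have [_ Se Sf f0 par] := gl.
pose D : 'rV[C]_n := \row_j (if j \in S then p 0 j ^- 2 else 1).
pose M := col_mx J (A *m diag_mx D).
have rM : (\rank M < n)%N.
  apply: leq_ltn_trans rJ; rewrite -addsmxE (leq_trans (mxrank_adds_leqif _ _)) //.
  by rewrite leq_add2l rank_leq_row.
have /rowV0Pn[w /sub_kermxP wM w0] : kermx M^T != 0.
  by rewrite -mxrank_eq0 mxrank_ker mxrank_tr subn_eq0 -ltnNge.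
have : M *m w^T = 0 by rewrite -[M]trmxK -trmx_mul wM trmx0.
rewrite mul_col_mx -[X in _ = X](@col_mx0 _ m d 1) => /eq_col_mx[/Jt tw AD].
pose x : 'rV_n := w *m diag_mx D.
have xE j : x 0 j = w 0 j * D 0 j by rewrite /x mul_mx_diag mxE.
have kx : x *m A^T = 0.
  by apply: trmx_inj; rewrite trmx0 !trmx_mul trmxK tr_diag_mx mulmxA.
have [v kv sv|z zE] := @row_interpolation _ _ _ A S x.
  rewrite -[RHS](proj1 tw v kv sv); apply: eq_bigr => j jS.
  by rewrite xE mxE jS mulrC mulrA.
pose w' : 'rV[C]_n := \row_j (if j \in S then 0 else w 0 j).
exists w'; last split=> [j|y Sy|a b aS bS ab].
- apply: contraNneq w0 => w'0.
  have wZ j : j \notin S -> w 0 j = 0.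
    by move=> jS; have /rowP/(_ j) := w'0; rewrite !mxE (negbTE jS).
  have sx : supported S x by move=> j jS; rewrite xE wZ // mul0r.
  have := pairing_supported (map_mx Num.conj z) kx sx.
  rewrite (eq_bigr (fun j => 1 ^+ 2 * ((z *m A) 0 j * ((z *m A) 0 j)^*))); last first.
    by move=> j jS; rewrite conj_pairing // zE // expr1n mul1r mulrC.
  move=> /(sum_normC_eq0 (fun=> fun=> rpred1 _)) K.
  apply/eqP/rowP => j; rewrite [RHS]mxE; have [jS|/wZ//] := boolP (j \in S).
  have := K j jS; rewrite mul1r zE // xE mxE jS => /eqP.
  have := jS; rewrite pS mulf_eq0 invr_eq0 sqrf_eq0 => /negPf->.
  by rewrite orbF => /eqP.
- by rewrite inE negbK mxE => ->.
- rewrite -[RHS](pairing0 y kx); apply: eq_bigr => j _; rewrite xE [w' _ _]mxE [D _ _]mxE.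
  by case: ifP => [/Sy->|_]; rewrite ?mul0r ?mulr1.
- by rewrite !mxE (negbTE aS) (negbTE bS); exact: (tangent_slope gl tw aS bS ab).
Qed.

Lemma hermitian_kernel q (N : 'M[C]_(q, n)) (c : 'rV[C]_n) :
  row_free N -> (forall w, (w <= N)%MS <-> class_vector w) ->
  \det (N *m diag_mx c *m (map_mx Num.conj N)^T) = 0 ->
  exists w, [/\ w != 0, class_vector w &
    forall w', class_vector w' -> \sum_j c 0 j * w 0 j * w' 0 j = 0].
Proof.
move=> fN NP /eqP/det0P[x x0 xN]; exists (x *m N); split.
- by rewrite mulmx_free_eq0.
- by apply/NP/submxMl.
move=> w' /class_vector_conj/NP/submxP[x' x'E].
have -> : w' = map_mx Num.conj x' *m map_mx Num.conj N.
  rewrite -map_mxM -x'E; apply/matrixP => i j; rewrite !mxE /=.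
  by rewrite conjCK.
set w'' := _ *m map_mx _ N.
have -> : \sum_j c 0 j * (x *m N) 0 j * w'' 0 j = (x *m N *m diag_mx c *m w''^T) 0 0.
  rewrite [RHS]mxE; apply: eq_bigr => j _; rewrite mul_mx_diag [w''^T _ _]mxE.
  by rewrite [X in _ = X * _]mxE [c _ _ * _]mulrC.
by rewrite /w'' trmx_mul !mulmxA -[x *m _ *m _]mulmxA -[x *m _ *m _]mulmxA xN mul0mx mxE.
Qed.

Lemma horner_det_form q (N P : 'M[C]_(q, n)) (r : 'rV[{poly C}]_n) t :
  (\det (map_mx polyC N *m diag_mx r *m (map_mx polyC P)^T)).[t] =
  \det (N *m diag_mx (map_mx (horner_eval t) r) *m P^T).
Proof.
rewrite -/(horner_eval t _) -det_map_mx !map_mxM map_diag_mx map_trmx.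
have cK a b (M : 'M[C]_(a, b)) : map_mx (horner_eval t) (map_mx polyC M) = M.
  by apply/matrixP => i j; rewrite !mxE /= /horner_eval hornerC.
by rewrite !cK.
Qed.

(** With weights [(le j + t * lf j) ^+ 2], the determinant of the form is nonconstant in t, because
    the weights [lf j ^+ 2] of t^2 give a positive definite form. A root where some
    [le a + t * lf a] vanishes would be real, which positivity and orthogonality to [f] exclude. *)
Lemma nonreal_root w0 : class_vector w0 -> w0 != 0 -> exists t w,
  [/\ class_vector w, w != 0, forall j, j \notin S -> le j + t * lf j != 0 &
    forall v, v *m A^T = 0 ->
      \sum_(j | j \notin S) (le j + t * lf j) ^+ 2 * w 0 j * v 0 j = 0].
Proof.
move=> cw0 w00; have [[re rf] Se Sf f0 par] := gl.
have lfR j : lf j \is Num.real by apply: real_coord.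
have leR j : le j \is Num.real by apply: real_coord.
have [N0 N0P] := class_vector_space.
pose q := \rank N0; pose N : 'M_(q, n) := row_base N0.
have fN : row_free N by apply: row_base_free.
have NP w : (w <= N)%MS <-> class_vector w by rewrite eq_row_base.
have q0 : (0 < q)%N.
  rewrite lt0n mxrank_eq0; apply: contraNneq w00 => N00.
  by move/N0P: cw0; rewrite N00 submx0.
pose N' := map_mx Num.conj N.
pose rQ : 'rV[{poly C}]_n := \row_j (if j \in S then 0 else ((le j)%:P + lf j *: 'X) ^+ 2).
(* [rR] is [rQ] at 1/t multiplied by t^2: the value of its determinant at 0 is the coefficient of
   t^(2q) in the determinant of [rQ]. *)
pose rR : 'rV[{poly C}]_n := \row_j (if j \in S then 0 else (le j *: 'X + (lf j)%:P) ^+ 2).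
pose form r := \det (map_mx polyC N *m diag_mx r *m (map_mx polyC N')^T).
have RQ t : t != 0 -> (form rR).[t] = t ^+ (2 * q) * (form rQ).[t^-1].
  move=> t0; rewrite !horner_det_form exprM -detZ scalemxAl scalemxAr; congr (\det (_ *m _ *m _)).
  rewrite -linearZ; congr diag_mx; apply/rowP => j; rewrite !mxE.
  rewrite /horner_eval; case: ifP => _; first by rewrite !horner0 mulr0.
  by rewrite !(horner_exp, hornerD, hornerC, hornerZ, hornerX) -exprMn; congr (_ ^+ _); field.
have R0 : (form rR).[0] != 0.
  rewrite horner_det_form; apply/eqP => /(hermitian_kernel fN NP)[w [wn0 cw]].
  move=> /(_ _ (class_vector_conj cw)) H; move/eqP: wn0; apply.
  have E : \sum_(j | j \notin S) lf j ^+ 2 * (w 0 j * (w 0 j)^*) = 0.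
    rewrite -[RHS]H [RHS](bigID (mem S)) /= [X in _ = X + _]big1 ?add0r.
      apply: eq_bigr => j jS; rewrite !mxE (negbTE jS) /horner_eval.
      by rewrite !(horner_exp, hornerD, hornerC, hornerZ, hornerX) mulr0 add0r mulrA.
    by move=> j jS; rewrite !mxE jS /horner_eval horner0 !mul0r.
  have K := sum_normC_eq0 (fun k _ => lfR k) E.
  apply/rowP => j; rewrite [RHS]mxE; have [jS|jS] := boolP (j \in S).
    by case: cw => -> //; rewrite inE jS.
  by have /eqP := K j jS; rewrite mulf_eq0 (negbTE (f0 j jS)) => /eqP.
have [t Qt] : exists t, root (form rQ) t.
  apply/closed_rootP/negP => /eqP/eqP/size_poly1P[c c0 Qc].
  have : form rR - c *: 'X^(2 * q) = 0.
    apply: (@poly_eq0_cofinite _ _ 'X); first by rewrite polyX_eq0.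
    move=> t; rewrite hornerX => t0; rewrite hornerD hornerN RQ // Qc hornerC.
    by rewrite hornerZ hornerXn mulrC subrr.
  move/subr0_eq => E; move: R0; rewrite E hornerZ hornerXn expr0n muln_eq0 /=.
  by rewrite eqn0Ngt q0 mulr0 eqxx.
move: Qt; rewrite /root horner_det_form => /eqP/(hermitian_kernel fN NP)[w [wn0 cw]].
set c := map_mx _ _ => Hw.
have cE j : j \notin S -> c 0 j = (le j + t * lf j) ^+ 2.
  move=> jS; rewrite !mxE (negbTE jS) /horner_eval.
  by rewrite !(horner_exp, hornerD, hornerC, hornerZ, hornerX) [t * _]mulrC.
have HZ w' : class_vector w' ->
    \sum_(j | j \notin S) (le j + t * lf j) ^+ 2 * w 0 j * w' 0 j = 0.
  move=> /[dup] cw' /Hw H; rewrite -[RHS]H [RHS](bigID (mem S)) /= [X in _ = X + _]big1 ?add0r.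
    by apply: eq_bigr => j jS; rewrite cE.
  by move=> j jS; case: cw' => -> //; rewrite ?mulr0 // inE jS.
exists t, w; split=> // [a aS|v kv]; last first.
  (* Averaging passes from class vectors to all kernel vectors. It applies because the coefficients
     divided by [lf j] are (tau_j + t)^2 lf_j w_j, constant on classes. *)
  have [w' cw' /(_ (fun j => (le j + t * lf j) ^+ 2 * w 0 j)) <-] := class_vector_average kv.
    exact: HZ.
  move=> a b aS bS ab; have wab : lf a * w 0 a = lf b * w 0 b by case: cw => _ _; apply.
  have lE j : j \notin S -> (le j + t * lf j) ^+ 2 * w 0 j / lf j =
      (tau j + t) ^+ 2 * (lf j * w 0 j).
    by move=> jS; have l0 : lf j != 0 := f0 j jS; rewrite /tau /slope -/(le j) -/(lf j); field.
  by rewrite !lE // ab wab.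
(* Here t = - tau_a is real, so by positivity [w] vanishes off the class of [a]. On that class
   [lf j * w 0 j] is constant, and orthogonality to [f] makes the constant 0. *)
apply: contra_neq wn0 => Ea; have la0 : lf a != 0 := f0 a aS.
have tE : t = - tau a.
  have -> : t = (le a + t * lf a) / lf a - le a / lf a by field.
  by rewrite Ea mul0r sub0r.
have tR : t \is Num.real by rewrite tE rpredN rpred_div.
have cR j : j \notin S -> le j + t * lf j \is Num.real.
  by move=> _; rewrite rpredD ?rpredM.
have E : \sum_(j | j \notin S) (le j + t * lf j) ^+ 2 * (w 0 j * (w 0 j)^*) = 0.
  rewrite -[RHS](HZ _ (class_vector_conj cw)); apply: eq_bigr => j jS.
  by rewrite [map_mx _ w _ _]mxE mulrA.
have K := sum_normC_eq0 cR E.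
have wS j : j \in S -> w 0 j = 0 by move=> jS; case: cw => -> //; rewrite inE jS.
have wa j : j \notin S -> lf j * w 0 j = lf a * w 0 a * (tau j == tau a)%:R.
  move=> jS; case: eqVneq => [ja|ja]; first by rewrite mulr1; case: cw => _ _; apply.
  have /eqP := K j jS; rewrite mulr0 mulf_eq0 => /orP[|/eqP->]; last by rewrite mulr0.
  move=> /eqP lj; move/eqP: ja; case; apply: oppr_inj; rewrite -tE.
  have lj0 : lf j != 0 := f0 j jS.
  have -> : t = (le j + t * lf j) / lf j - le j / lf j by field.
  by rewrite lj mul0r sub0r.
have : \sum_(j | j \notin S) lf j * w 0 j = 0.
  case: cw => _ /(_ f Sf) + _; rewrite (bigID (mem S)) /= [X in X + _]big1 ?add0r //.
  by move=> j /wS->; rewrite mulr0.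
rewrite (eq_bigr _ wa) -mulr_sumr => /eqP; rewrite mulf_eq0 => /orP[/eqP wa0|].
  apply/rowP => j; rewrite [RHS]mxE; have [/wS//|jS] := boolP (j \in S).
  have /eqP := wa j jS; rewrite wa0 mul0r mulf_eq0 => /orP[|/eqP//].
  by rewrite (negbTE (f0 j jS)).
rewrite psumr_eq0 => [/allP/(_ a (mem_index_enum a))|j _]; last by rewrite ler0n.
by rewrite aS eqxx /= oner_eq0.
Qed.

End NonrealRoot.

Lemma mul_diag_tr (F : comNzRingType) n (k w D : 'rV[F]_n) :
  (k *m diag_mx D *m w^T) 0 0 = \sum_j D 0 j * k 0 j * w 0 j.
Proof.
rewrite mxE; apply: eq_bigr => j _; rewrite mul_mx_diag [w^T _ _]mxE.
by rewrite [X in X * _]mxE [k _ _ * _]mulrC.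
Qed.

Lemma rowD (V : nmodType) n (a b : 'rV[V]_n) j : (a + b) 0 j = a 0 j + b 0 j.
Proof. by rewrite mxE. Qed.

Lemma rowZ (F : pzRingType) n c (a : 'rV[F]_n) j : (c *: a) 0 j = c * a 0 j.
Proof. by rewrite mxE. Qed.

(** * Limits of ramification points *)

Section Limit.
Variables (C : numClosedFieldType) (d n : nat) (A : 'M[C]_(d, n)).
Hypothesis realA : map_mx Num.conj A = A.
Hypothesis freeA : row_free A.
Variable S : {set 'I_n}.
Hypothesis flatS : is_flat A S.
Implicit Types (v w x g p D : 'rV[C]_n) (y z : 'rV[C]_d).

Let K : 'M[C]_n := kermx A^T.
Let KS : 'M[C]_n := (K :&: kermx (diag_mx (\row_j (j \notin S)%:R)))%MS.

Lemma flat_kernelP v : (v <= KS)%MS <-> v *m A^T = 0 /\ supported S v.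
Proof.
rewrite sub_capmx; split=> [/andP[/sub_kermxP kv /sub_kermxP sv]|[kv sv]].
  split=> // j jS; have /rowP/(_ j) := sv.
  by rewrite mul_mx_diag !mxE jS mulr1.
apply/andP; split; apply/sub_kermxP => //; apply/rowP => j.
rewrite mul_mx_diag !mxE; case: (boolP (j \in S)) => [_|/sv->].
  by rewrite mulr0.
by rewrite mul0r.
Qed.

Lemma conj_ker v : v *m A^T = 0 -> map_mx Num.conj v *m A^T = 0.
Proof.
by move=> kv; rewrite -realA map_trmx -map_mxM kv map_mx0.
Qed.

(* The condition D2 = s^2 D1 on S is what makes the degeneration s -> 0 of the
   ramification equations flat. *)
Lemma degeneration_matrix : exists P0 P1 : 'M[C]_n,
  forall s (D1 D2 w : 'rV[C]_n), (forall j, j \in S -> D2 0 j = s ^+ 2 * D1 0 j) ->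
  (P0 + (1%:M - P0) *m (P1 *m diag_mx D1 + (1%:M - P1) *m diag_mx D2)) *m w^T = 0
  <-> [/\ w *m A^T = 0,
        forall k : 'rV_n, k *m A^T = 0 -> supported S k -> k *m diag_mx D1 *m w^T = 0 &
        forall k : 'rV_n, k *m A^T = 0 -> k *m diag_mx D2 *m w^T = 0].
Proof.
pose L : 'M[C]_n := <<A>>%MS.
(* By positivity the row space of a real matrix meets its kernel only in 0. So [P0] can project onto
   the row space along the kernel; [P1] projects onto the kernel vectors supported on [S]. *)
have LK : (L :&: K = 0)%MS.
  apply/eqP/rowV0P => v; rewrite sub_capmx genmxE => /andP[/submxP[y vE] /sub_kermxP kv].
  have := pairing0 (map_mx Num.conj y) kv.
  rewrite (eq_bigr (fun j => 1 ^+ 2 * (v 0 j * (v 0 j)^*))); last first.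
    by move=> j _; rewrite conj_pairing // -vE expr1n mul1r mulrC.
  move=> /(sum_normC_eq0 (fun=> fun=> rpred1 _)) H.
  by apply/rowP => j; rewrite [RHS]mxE -[LHS]mul1r H.
have LKfull : (1%:M <= L + K)%MS.
  rewrite sub1mx -col_leq_rank -(leq_add2r (\rank (L :&: K)%MS)) mxrank_sum_cap.
  by rewrite LK mxrank0 addn0 genmxE mxrank_ker mxrank_tr subnKC // rank_leq_col.
have KSC : (KS :&: KS^C = 0)%MS by apply/capmx_compl.
pose P0 := proj_mx L K; pose P1 := proj_mx KS (KS^C)%MS.
have P0L v : (v *m P0 <= A)%MS by rewrite -(genmxE A) proj_mx_sub.
have P0id (v : 'rV_n) : (v <= A)%MS -> v *m P0 = v.
  by move=> vA; rewrite proj_mx_id ?LK ?genmxE.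
have P0K (v : 'rV_n) : v *m A^T = 0 -> v *m P0 = 0.
  by move=> /sub_kermxP vK; rewrite proj_mx_0 ?LK.
have P0C (v : 'rV_n) : (v - v *m P0) *m A^T = 0.
  apply/sub_kermxP; rewrite proj_mx_compl_sub //.
  by rewrite (submx_trans _ LKfull) // submx1.
have P0P0 : P0 *m P0 = P0 by rewrite [LHS]proj_mx_id ?LK // -[P0]mul1mx proj_mx_sub.
have P1KS v : v *m P1 *m A^T = 0 /\ supported S (v *m P1).
  by apply/flat_kernelP/proj_mx_sub.
have P1id v : v *m A^T = 0 -> supported S v -> v *m P1 = v.
  by move=> kv sv; rewrite proj_mx_id //; apply/flat_kernelP.
move: P0 P1 P0L P0id P0K P0C P0P0 P1KS P1id => P0 P1 P0L P0id P0K P0C P0P0 P1KS P1id.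
exists P0, P1 => s D1 D2 w D12.
have Ds (k : 'rV_n) : supported S k -> k *m diag_mx D2 = s ^+ 2 *: (k *m diag_mx D1).
  move=> sk; apply/rowP => j; rewrite !mul_mx_diag !mxE.
  case: (boolP (j \in S)) => [/D12->|/sk->]; last by rewrite !mul0r mulr0.
  by rewrite mulrCA.
split=> [H|[Aw H1 H2]].
  have {}P0w : P0 *m w^T = 0.
    move/(congr1 (mulmx P0)): H; set X := P1 *m _ + _.
    rewrite mulmx0 mulmxA mulmxDr P0P0.
    by rewrite mulmxA mulmxBr mulmx1 P0P0 subrr mul0mx addr0.
  have H' : (1%:M - P0) *m (P1 *m diag_mx D1 + (1%:M - P1) *m diag_mx D2) *m w^T = 0.
    by move: H; rewrite (mulmxDl P0) P0w add0r.
  have kE (k : 'rV_n) : k *m A^T = 0 ->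
      k *m P1 *m diag_mx D1 *m w^T + (k - k *m P1) *m diag_mx D2 *m w^T = 0.
    move=> /P0K kP0.
    move/(congr1 (mulmx k)): H'; rewrite mulmx0 mulmxA.
    rewrite [k *m (_ *m _)]mulmxA [k *m (_ - _)]mulmxBr mulmx1 kP0 subr0.
    by rewrite mulmxDr mulmxDl !(mulmxA k) [k *m (_ - _)]mulmxBr mulmx1.
  have H1 (k : 'rV_n) : k *m A^T = 0 -> supported S k -> k *m diag_mx D1 *m w^T = 0.
    move=> kk sk; have kP1 := P1id k kk sk.
    by have := kE k kk; rewrite kP1 subrr !mul0mx addr0.
  split=> // [|k kk].
    apply: pairing_eq0 => y; rewrite pairingE trmx_mul trmxK.
    by rewrite mulmxA -(P0id (y *m A)) ?submxMl // -mulmxA P0w mulmx0 mxE.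
  have [kP sP] := P1KS k.
  have := kE k kk; rewrite (H1 _ kP sP) add0r mulmxBl mulmxBl (Ds _ sP) -scalemxAl.
  by rewrite (H1 _ kP sP) scaler0 subr0.
have row0P (M : 'M[C]_n) (v : 'cV[C]_n) : (forall x, x *m M *m v = 0) -> M *m v = 0.
  by move=> Hx; apply/row_matrixP => i; rewrite row0 row_mul rowE Hx.
rewrite (mulmxDl P0) (row0P P0) => [|x]; last first.
  have /submxP[y ->] := P0L x.
  by rewrite -mulmxA -[A]trmxK -trmx_mul Aw trmx0 mulmx0.
rewrite add0r -mulmxA [(P1 *m _ + _) *m _]mulmxDl mulmxDr.
have -> : P1 *m diag_mx D1 *m w^T = 0.
  by rewrite -mulmxA; apply: row0P => x; have [? ?] := P1KS x; rewrite mulmxA H1.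
rewrite mulmx0 add0r.
have -> : (1%:M - P1) *m diag_mx D2 *m w^T = diag_mx D2 *m w^T.
  rewrite mulmxBl mul1mx mulmxBl [X in _ - X](_ : _ = 0) ?subr0 //.
  by rewrite -mulmxA; apply: row0P => x; have [? ?] := P1KS x; rewrite mulmxA H2.
apply: row0P => x; rewrite mulmxA.
by rewrite mulmxBr mulmx1 H2.
Qed.

Definition masked_inv y : 'I_n -> C :=
  fun j => if j \in S then ((y *m A) 0 j)^-1 else 0.

(** For [y] real and without zeros on [S] this holds by positivity; a general [y] is later deformed
    to a real one. *)
Definition flat_form_nondegenerate y := forall w : 'rV_n, w *m A^T = 0 -> supported S w ->
  (forall k : 'rV_n, k *m A^T = 0 -> supported S k ->
     \sum_(j in S) ((y *m A) 0 j) ^+ 2 * k 0 j * w 0 j = 0) -> w = 0.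

(** The tangent space at 1/u, u = y A, is the row space divided entrywise by u^2. A vector w of the
    kernel of A lies in it when u^2 w is orthogonal to that kernel. *)
Definition ramified_at y := exists w : 'rV_n, [/\ w != 0, w *m A^T = 0 &
  forall k : 'rV_n, k *m A^T = 0 -> \sum_j ((y *m A) 0 j) ^+ 2 * k 0 j * w 0 j = 0].

Lemma supported_sum D k w : supported S k ->
  \sum_j D 0 j * k 0 j * w 0 j = \sum_(j in S) D 0 j * k 0 j * w 0 j.
Proof.
move=> sk; rewrite (bigID (mem S)) /= [X in _ + X]big1 ?addr0 // => j /sk->.
by rewrite mulr0 mul0r.
Qed.

(** The Gram matrix [M] of the form on the kernel vectors supported on [S] is invertible, so the
    functional defined by [x] is represented by such a vector. *)
Lemma flat_form_completion y x : flat_form_nondegenerate y ->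
  exists v : 'rV_n, [/\ v *m A^T = 0, supported S v &
    forall k : 'rV_n, k *m A^T = 0 -> supported S k ->
      \sum_(j in S) ((y *m A) 0 j) ^+ 2 * k 0 j * (x 0 j + v 0 j) = 0].
Proof.
move=> nd; pose q := \rank KS; pose N : 'M_(q, n) := row_base KS.
have NP w : (w <= N)%MS <-> w *m A^T = 0 /\ supported S w.
  by rewrite eq_row_base; apply: flat_kernelP.
pose D : 'rV[C]_n := \row_j ((y *m A) 0 j) ^+ 2.
pose M := N *m diag_mx D *m N^T.
have sumE k w : supported S k ->
    \sum_(j in S) ((y *m A) 0 j) ^+ 2 * k 0 j * w 0 j = (k *m diag_mx D *m w^T) 0 0.
  move=> sk; rewrite mul_diag_tr supported_sum //.
  by apply: eq_bigr => j _; rewrite [D _ _]mxE.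
have Mu : M \in unitmx.
  rewrite unitmxE unitfE; apply/eqP => /eqP/det0P[c c0 cM]; move/eqP: c0; apply.
  apply/eqP; rewrite -(mulmx_free_eq0 c (row_base_free KS)); apply/eqP.
  have [kw sw] := (NP (c *m N)).1 (submxMl _ _).
  apply: nd => // k kk sk; have /submxP[b ->] := (NP k).2 (conj kk sk).
  transitivity (\sum_(j in S) (y *m A) 0 j ^+ 2 * (c *m N) 0 j * (b *m N) 0 j).
    by apply: eq_bigr => j _; rewrite mulrAC.
  rewrite sumE // trmx_mul.
  have -> : c *m N *m diag_mx D *m (N^T *m b^T) = c *m M *m b^T by rewrite /M !mulmxA.
  by rewrite cM mul0mx mxE.
pose c := - (x *m diag_mx D *m N^T) *m invmx M.
have [kv sv] := (NP (c *m N)).1 (submxMl _ _).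
exists (c *m N); split=> // k kk sk; have /submxP[b kE] := (NP k).2 (conj kk sk).
transitivity (((x + c *m N) *m diag_mx D *m k^T) 0 0).
  rewrite mul_diag_tr; transitivity (\sum_j D 0 j * k 0 j * (x + c *m N) 0 j).
    rewrite supported_sum //; apply: eq_bigr => j _.
    by rewrite [D _ _]mxE rowD.
  by apply: eq_bigr => j _; rewrite mulrAC.
rewrite kE trmx_mul mulmxA !mulmxDl.
have -> : c *m N *m diag_mx D *m N^T = c *m M by rewrite /M !mulmxA.
by rewrite /c mulmxKV // -mulmxDl subrr mul0mx mxE.
Qed.

(** * The family s y + e + t f near s = 0 *)

Section Degeneration.
Variables (y e f : 'rV[C]_d).
Hypothesis gl : generic_line A S e f.
Hypothesis yS : forall j, j \in S -> (y *m A) 0 j != 0.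
Hypothesis nd : flat_form_nondegenerate y.

Let u j := (y *m A) 0 j.
Let U j : {poly {poly C}} :=
  ((e *m A) 0 j)%:P%:P + ((f *m A) 0 j)%:P *: 'X + (u j *: 'X)%:P.

Lemma hornerU j s t :
  (U j).[t%:P].[s] = ((s *: y + e + t *: f) *m A) 0 j.
Proof.
rewrite !(hornerD, hornerZ, hornerC, hornerX, hornerM) !mulmxDl -!scalemxAl.
rewrite !rowD !rowZ.
by rewrite -/(u j); ring.
Qed.

(** Coordinates of s/u, u = (s y + e + t f) A, multiplied by the product of the U_k with k outside
    of [S]. On [S] the factor s cancels, which gives polynomials with the right value at s = 0. *)
Let X j : {poly {poly C}} := (if j \in S then ((u j)^-1)%:P%:P else 'X%:P) *
  \prod_(k | (k \notin S) && (k != j)) U k.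

Lemma hornerX_prod j s t :
  (X j).[t%:P].[s] * (if j \in S then u j else (U j).[t%:P].[s]) =
  (if j \in S then 1 else s) * \prod_(k | k \notin S) (U k).[t%:P].[s].
Proof.
rewrite /X !hornerM !horner_prod; case: ifPn => jS.
  rewrite !hornerC mulrAC mulVf ?yS //; congr (_ * _); apply: eq_bigl => k.
  by case: eqVneq => [->|_]; rewrite ?jS ?andbT.
by rewrite !(hornerC, hornerX) [in RHS](bigD1 j) //= -mulrA; congr (_ * _); rewrite mulrC.
Qed.

Lemma limit_vanishing (F : {mpoly C[n]}) k w0 :
  F \is k.-homog ->
  (forall z, (forall j, (z *m A) 0 j != 0) -> ramified_at z ->
     F.@[fun j => ((z *m A) 0 j)^-1] = 0) ->
  class_vector A S e f w0 -> w0 != 0 -> F.@[masked_inv y] = 0.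
Proof.
move=> homF HF cw0 w00; have [[re rf] Se Sf f0 _] := gl.
have [t0 [w [cw wn0 nr Hw]]] := nonreal_root realA gl cw0 w00.
have [P0 [P1 HP]] := degeneration_matrix.
pose D1 : 'rV[C]_n := \row_j (if j \in S then u j ^+ 2 else 0).
pose D2 s t : 'rV[C]_n := \row_j (U j).[t%:P].[s] ^+ 2.
pose Psi s t := P0 + (1%:M - P0) *m (P1 *m diag_mx D1 + (1%:M - P1) *m diag_mx (D2 s t)).
have US j s t : j \in S -> (U j).[t%:P].[s] = s * u j.
  move=> jS; rewrite hornerU !mulmxDl -!scalemxAl !rowD !rowZ.
  by rewrite Se // Sf // mulr0 !addr0.
have D12 s t j : j \in S -> D2 s t 0 j = s ^+ 2 * D1 0 j.
  by move=> jS; rewrite !mxE jS US // exprMn.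
pose cc := polyC \o polyC : C -> {poly {poly C}}.
(* For s != 0 the vanishing of [G] is the ramification equation. At s = 0 the weights [D2] vanish on
   [S], and the equations with [D1] retain the information lost there. *)
pose G := \det (map_mx cc P0 + (1%:M - map_mx cc P0) *m
   (map_mx cc P1 *m diag_mx (map_mx cc D1) +
    (1%:M - map_mx cc P1) *m diag_mx (\row_j U j ^+ 2))).
have GE s t : G.[t%:P].[s] = \det (Psi s t).
  pose ev : {rmorphism {poly {poly C}} -> C} := horner_eval s \o horner_eval t%:P.
  rewrite -[LHS]/(ev G) -det_map_mx; congr (\det _).
  have evc a b (M : 'M[C]_(a, b)) : map_mx ev (map_mx cc M) = M.
    by apply/matrixP => i j; rewrite !mxE /= /horner_eval !hornerC.
  rewrite map_mxD map_mxM map_mxB map_mx1 map_mxD !map_mxM map_mxB map_mx1.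
  rewrite !map_diag_mx !evc; congr (_ + _ *m (_ + _ *m diag_mx _)).
  by apply/rowP => j; rewrite !mxE /= /horner_eval !horner_exp.
have PsiP s t : G.[t%:P].[s] = 0 <-> exists w : 'rV_n, [/\ w != 0, w *m A^T = 0,
    forall k : 'rV_n, k *m A^T = 0 -> supported S k -> \sum_(j in S) u j ^+ 2 * k 0 j * w 0 j = 0 &
    forall k : 'rV_n, k *m A^T = 0 -> \sum_j (U j).[t%:P].[s] ^+ 2 * k 0 j * w 0 j = 0].
  have D1E (k1 w1 : 'rV_n) : supported S k1 ->
      \sum_(j in S) u j ^+ 2 * k1 0 j * w1 0 j = (k1 *m diag_mx D1 *m w1^T) 0 0.
    move=> sk; rewrite mul_diag_tr supported_sum //.
    by apply: eq_bigr => j jS; rewrite [D1 _ _]mxE jS.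
  have D2E (k1 w1 : 'rV_n) : \sum_j (U j).[t%:P].[s] ^+ 2 * k1 0 j * w1 0 j =
      (k1 *m diag_mx (D2 s t) *m w1^T) 0 0.
    by rewrite mul_diag_tr; apply: eq_bigr => j _; rewrite [D2 _ _ _ _]mxE.
  rewrite GE -det_tr; split=> [/eqP/det0P[w1 w1n0 w1P]|[w1 [w1n0 kw H1 H2]]].
    exists w1; have /(HP s D1 (D2 s t) w1 (D12 s t))[kw H1 H2] : Psi s t *m w1^T = 0.
      by apply: trmx_inj; rewrite trmx_mul trmxK w1P trmx0.
    split=> // [k1 kk sk|k1 kk]; first by rewrite D1E // H1 // mxE.
    by rewrite D2E H2 // mxE.
  apply/eqP/det0P; exists w1 => //; apply: trmx_inj; rewrite trmx_mul trmxK trmx0.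
  apply/(HP s D1 (D2 s t) w1 (D12 s t)); split=> // [k1 kk sk|k1 kk];
    apply/matrixP => i j; rewrite !ord1 [RHS]mxE.
    by rewrite -D1E // H1.
  by rewrite -D2E H2.
have U0 j t : (U j).[t%:P].[0] = (e *m A) 0 j + t * (f *m A) 0 j.
  rewrite hornerU scale0r add0r mulmxDl -scalemxAl.
  by rewrite rowD rowZ.
have gen : exists t1 : C, t1 \is Num.real /\ forall j, j \notin S -> (U j).[t1%:P].[0] != 0.
  pose B := \prod_(j | j \notin S) (((e *m A) 0 j)%:P + (f *m A) 0 j *: 'X).
  have /poly_exists_nonroot[m] : B != 0.
    apply/prodf_neq0 => j jS; apply: contraNneq (f0 j jS) => E.
    have := congr1 (fun r : {poly C} => r`_1) E.
    by rewrite coefD coefC coefZ coefX coef0 mulr1 add0r => ->.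
  rewrite horner_prod_neq0 => /forall_inP Hm; exists m%:R; split; first exact: realn.
  move=> j /Hm; rewrite U0.
  by rewrite hornerD hornerC hornerZ hornerX [_ * m%:R]mulrC.
(* At a real t1 where no form outside of [S] vanishes, positivity kills a solution outside of [S]
   and [nd] kills it on [S]. *)
have G0 : eval_coefs 0 G != 0.
  have [t1 [t1R t1U]] := gen.
  apply/eqP => /(congr1 (fun r : {poly C} => r.[t1])); rewrite horner0 -eval_coefsE.
  move=> /PsiP[v [vn0 kv H1 H2]]; move/eqP: vn0; apply.
  have := H2 _ (conj_ker kv); rewrite (bigID (mem S)) /= big1 ?add0r; last first.
    by move=> j jS; rewrite US // !mul0r expr0n /= !mul0r.
  rewrite (eq_bigr (fun j => (U j).[t1%:P].[0] ^+ 2 * (v 0 j * (v 0 j)^*))); last first.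
    by move=> j _; rewrite [map_mx _ _ _ _]mxE -mulrA [_^* * _]mulrC.
  have UR j : j \notin S -> (U j).[t1%:P].[0] \is Num.real.
    by move=> _; rewrite U0 rpredD ?rpredM ?real_coord.
  move=> /(sum_normC_eq0 UR) vZ; apply: nd => // j jS.
  by have /eqP := vZ j jS; rewrite mulf_eq0 (negbTE (t1U j jS)) => /eqP.
(* The extra product makes [N] vanish also where some U_k is 0 and u has no entrywise inverse. *)
pose N := mmap cc X F * \prod_(k | k \notin S) U k.
have NE s t : N.[t%:P].[s] = F.@[fun j => (X j).[t%:P].[s]] *
    \prod_(k | k \notin S) (U k).[t%:P].[s].
  by rewrite /N !hornerM horner_horner_mmap !horner_prod.
(* The vector of [nonreal_root] becomes a kernel vector after adding [x] supported on [S]; then [v]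
   corrects the [D1] equations. The remaining equations at s = 0 involve only coordinates outside of
   [S]. *)
have Gt0 : G.[t0%:P].[0] = 0.
  apply/PsiP; case: (cw) => sw yw _.
  have [|x [sx xE]] := @column_interpolation _ _ _ A S (- (w *m A^T)^T).
    move=> z Sz; apply/matrixP => i j; rewrite !ord1 mulmxN [LHS]mxE -pairingE yw //.
    by rewrite oppr0 mxE.
  rewrite linearN /= trmxK in xE.
  have [v [kv sv Hv]] := flat_form_completion x nd.
  have wS j : j \in S -> w 0 j = 0 by move=> jS; rewrite sw // inE jS.
  exists (w + x + v); split.
  - apply: contra_neq wn0 => E; apply/rowP => j; rewrite [RHS]mxE.
    have [/wS//|jS] := boolP (j \in S).
    by have /rowP/(_ j) := E; rewrite !mxE sx // sv // !addr0.
  - by rewrite !mulmxDl xE kv addr0 subrr.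
  - move=> k1 kk sk; rewrite -[RHS](Hv k1 kk sk); apply: eq_bigr => j jS.
    by rewrite !rowD wS // add0r.
  - move=> k1 kk; rewrite (bigID (mem S)) /= big1 ?add0r; last first.
      by move=> j jS; rewrite US // !mul0r expr0n /= !mul0r.
    rewrite -[RHS](Hw k1 kk); apply: eq_bigr => j jS.
    by rewrite U0 !rowD sx // sv // !addr0 mulrAC.
have GN s t : s != 0 -> G.[t%:P].[s] = 0 -> N.[t%:P].[s] = 0.
  move=> s0 /PsiP[v [vn0 kv _ Hv]]; rewrite NE.
  have [->|Un0] := eqVneq (\prod_(k | k \notin S) (U k).[t%:P].[s]) 0.
    by rewrite mulr0.
  pose z := s *: y + e + t *: f.
  have zU j : (z *m A) 0 j != 0.
    rewrite -hornerU; have [jS|jS] := boolP (j \in S).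
      by rewrite US // mulf_neq0 // yS.
    by move/prodf_neq0: Un0; apply.
  have Fz : F.@[fun j => ((z *m A) 0 j)^-1] = 0.
    apply: HF => //; exists v; split=> // k1 kk; rewrite -[RHS](Hv k1 kk).
    by apply: eq_bigr => j _; rewrite hornerU.
  rewrite (@meval_homog _ _ _ _ (s * \prod_(k | k \notin S) (U k).[t%:P].[s])
    (fun j => ((z *m A) 0 j)^-1) _ homF) ?Fz ?mulr0 ?mul0r //.
  move=> j; apply: (mulIf (zU j)); rewrite mulfVK // -hornerU.
  have := hornerX_prod j s t; have [jS|jS] := boolP (j \in S); last by [].
  by rewrite US // mul1r mulrCA => ->.
have := specialization G0 GN Gt0; rewrite NE => /eqP; rewrite mulf_eq0 orbC.
have Un0 : \prod_(k | k \notin S) (U k).[t0%:P].[0] != 0.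
  by apply/prodf_neq0 => j jS; rewrite U0 nr.
rewrite (negbTE Un0) /= (@meval_homog _ _ _ _
  (\prod_(k | k \notin S) (U k).[t0%:P].[0]) (masked_inv y) _ homF).
  by rewrite mulf_eq0 expf_eq0 (negbTE Un0) andbF => /eqP.
move=> j; have := hornerX_prod j 0 t0; rewrite /masked_inv -/(u j).
case: ifPn => jS E; first by rewrite mul1r in E; rewrite -E mulfK // yS.
rewrite mul0r in E; rewrite mulr0; apply/eqP; move/eqP: E; rewrite mulf_eq0.
by rewrite U0 (negbTE (nr j jS)) orbF.
Qed.

End Degeneration.

(** On the line from [y] to a real [z] without zeros on [S], the determinant of the form on [S] is a
    polynomial, nonzero at [z] by positivity. So [limit_vanishing] applies for all but finitely many
    parameters, and the vanishing extends to [y] after clearing denominators. *)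
Lemma degenerate_limit_vanishing (F : {mpoly C[n]}) k y e f w0 :
  generic_line A S e f -> (forall j, j \in S -> (y *m A) 0 j != 0) ->
  F \is k.-homog ->
  (forall z, (forall j, (z *m A) 0 j != 0) -> ramified_at z ->
     F.@[fun j => ((z *m A) 0 j)^-1] = 0) ->
  class_vector A S e f w0 -> w0 != 0 -> F.@[masked_inv y] = 0.
Proof.
move=> gl yS homF HF cw0 w00.
have [j jS|z [rz _ zS]] :=
    @real_generic _ _ _ A realA _ (fun j => j \in S) (fun j => col j A) finset.set0.
  exists y; first by move=> i; rewrite inE.
  by apply: contraNneq (yS j jS) => E; rewrite -mulmx_col E mxE.
have [q [N [fN NP]]] : exists q (N : 'M[C]_(q, n)), row_free N /\
    forall w, (w <= N)%MS <-> w *m A^T = 0 /\ supported S w.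
  exists (\rank KS), (row_base KS); split; first exact: row_base_free.
  by move=> w; rewrite eq_row_base; apply: flat_kernelP.
pose line t := y + t *: (z - y).
pose L j : {poly C} := ((y *m A) 0 j)%:P + (((z - y) *m A) 0 j) *: 'X.
have LE j t : (L j).[t] = (line t *m A) 0 j.
  rewrite hornerD hornerC hornerZ hornerX /line [in RHS]mulmxDl -scalemxAl.
  by rewrite rowD rowZ [t * _]mulrC.
have line1 : line 1 = z by rewrite /line scale1r addrC subrK.
have line0 : line 0 = y by rewrite /line scale0r addr0.
pose r : 'rV[{poly C}]_n := \row_j (if j \in S then L j ^+ 2 else 0).
pose D := \det (map_mx polyC N *m diag_mx r *m (map_mx polyC N)^T).
have sumE (b w : 'rV_n) t : supported S b ->
    \sum_(j in S) ((line t *m A) 0 j) ^+ 2 * b 0 j * w 0 j =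
    (b *m diag_mx (map_mx (horner_eval t) r) *m w^T) 0 0.
  move=> sb; rewrite mul_diag_tr supported_sum //; apply: eq_bigr => j jS.
  by rewrite -LE [map_mx _ _ _ _]mxE [r _ _]mxE jS /horner_eval horner_exp.
have DP t : D.[t] != 0 -> flat_form_nondegenerate (line t).
  rewrite horner_det_form -unitfE -unitmxE; set c := map_mx _ _ => Mu w kw sw Hw.
  have /submxP[b bE] := (NP w).2 (conj kw sw).
  suff E : b *m (N *m diag_mx c *m N^T) = 0.
    by rewrite bE -[b](mulmxK Mu) E !mul0mx.
  apply/rowP => i; rewrite [RHS]mxE !mulmxA -bE.
  have [kN sN] := (NP (row i N)).1 (row_sub _ _).
  rewrite -[RHS](Hw _ kN sN); transitivity ((w *m diag_mx c *m (row i N)^T) 0 0).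
    by rewrite !mxE; apply: eq_bigr => j _; rewrite !mxE.
  by rewrite -sumE //; apply: eq_bigr => j _; rewrite mulrAC.
have D1 : D.[1] != 0.
  rewrite horner_det_form; apply/eqP => /eqP/det0P[b b0 bM]; move/eqP: b0; apply.
  apply/eqP; rewrite -(mulmx_free_eq0 b fN); apply/eqP.
  have [kw sw] := (NP (b *m N)).1 (submxMl _ _).
  have sw' : supported S (map_mx Num.conj (b *m N)).
    by move=> j /sw; rewrite [X in _ -> X = _]mxE => ->; rewrite rmorph0.
  have /submxP[b' b'E] := (NP _).2 (conj (conj_ker kw) sw').
  have : \sum_(j in S) ((z *m A) 0 j) ^+ 2 * ((b *m N) 0 j * ((b *m N) 0 j)^*) = 0.
    transitivity (\sum_(j in S) ((line 1 *m A) 0 j) ^+ 2 * (b *m N) 0 j *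
                   (map_mx Num.conj (b *m N)) 0 j).
      by apply: eq_bigr => j _; rewrite line1 mulrA [map_mx _ _ _ _]mxE.
    rewrite sumE // b'E trmx_mul; set c := map_mx _ _.
    have -> : b *m N *m diag_mx c *m (N^T *m b'^T) = b *m (N *m diag_mx c *m N^T) *m b'^T.
      by rewrite !mulmxA.
    by rewrite bM mul0mx mxE.
  have zR j : j \in S -> (z *m A) 0 j \is Num.real by move=> _; apply: real_coord.
  move=> /(sum_normC_eq0 zR) H; apply/rowP => j; rewrite [RHS]mxE.
  have [jS|/sw//] := boolP (j \in S); have /eqP := H j jS.
  by rewrite mulf_eq0 -mulmx_col (negbTE (zS j jS)) => /eqP.
pose X j : {poly C} := if j \in S then \prod_(k | (k \in S) && (k != j)) L k else 0.
have XE t : (forall j, j \in S -> (line t *m A) 0 j != 0) -> forall j,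
    (X j).[t] = \prod_(k in S) (line t *m A) 0 k * masked_inv (line t) j.
  move=> lt0 j; rewrite /X /masked_inv; case: ifP => jS; last by rewrite horner0 mulr0.
  rewrite [in RHS](bigD1 j) //= mulrC mulrA mulVf ?lt0 // mul1r horner_prod.
  by apply: eq_bigr => i _; rewrite LE.
have P0 : mmap polyC X F = 0.
  apply: (@poly_eq0_cofinite _ _ (D * \prod_(j in S) L j)).
    apply/eqP => E; have := congr1 (fun q : {poly C} => q.[1]) E.
    rewrite horner0 => /eqP; apply/negP.
    rewrite hornerM mulf_neq0 // horner_prod_neq0; apply/forall_inP => j jS.
    by rewrite LE line1 -mulmx_col zS.
  move=> t; rewrite hornerM mulf_eq0 negb_or horner_prod_neq0.
  move=> /andP[/DP ndt /forall_inP Lt].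
  have lt0 j : j \in S -> (line t *m A) 0 j != 0 by move/Lt; rewrite LE.
  rewrite horner_mmap (@meval_homog _ _ _ _ _ (masked_inv (line t)) _ homF (XE t lt0)).
  by rewrite (limit_vanishing gl lt0 ndt homF HF cw0 w00) mulr0.
have /(congr1 (fun q : {poly C} => q.[0])) := P0.
have lt0 j : j \in S -> (line 0 *m A) 0 j != 0 by rewrite line0; apply: yS.
rewrite horner_mmap (@meval_homog _ _ _ _ _ (masked_inv (line 0)) _ homF (XE 0 lt0)).
rewrite horner0 line0 => /eqP; rewrite mulf_eq0 expf_eq0.
suff /negPf-> : \prod_(k in S) (y *m A) 0 k != 0 by rewrite andbF => /eqP.
by apply/prodf_neq0.
Qed.

End Limit.

(** * Circuit polynomials and their gradients *)

Section Circuits.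
Variables (R : realType) (d n : nat) (A : 'M[R]_(d, n)).
Variable cv : {set 'I_n} -> 'cV[R]_n.
Hypothesis cvP : circuit_vectors A cv.
Local Notation C := R[i].
Local Notation Ac := (map_mx (real_complex R) A).
Implicit Types (v w p : 'rV[C]_n) (D : {set 'I_n}).

Definition circuit_row D : 'rV[C]_n := (map_mx (real_complex R) (cv D))^T.

Lemma circuit_row_ker D : D \in circuits A -> circuit_row D *m Ac^T = 0.
Proof.
by move=> /cvP[kD _]; rewrite -trmx_mul -map_mxM kD map_mx0 trmx0.
Qed.

Lemma circuit_row_neq0 D j : D \in circuits A -> (circuit_row D 0 j != 0) = (j \in D).
Proof.
by move=> /cvP[_ sD]; rewrite -[in RHS]sD inE !mxE fmorph_eq0.
Qed.

Lemma real_Ac : map_mx Num.conj Ac = Ac.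
Proof.
apply/matrixP => i j; rewrite !mxE /=; apply/CrealP.
by rewrite complex_real.
Qed.

Lemma row_free_Ac : \rank A = d -> row_free Ac.
Proof. by move=> rA; rewrite /row_free mxrank_map rA. Qed.

Lemma dependent_support v : v *m Ac^T = 0 -> v != 0 ->
  dependent_cols A [set j | v 0 j != 0].
Proof.
move=> kv v0; set D := [set j | _]; rewrite /dependent_cols.
rewrite -(row_free_map (real_complex R)) map_mxsub -map_trmx.
pose u : 'rV[C]_#|D| := \row_k v 0 (enum_val k).
have uA : u *m rowsub (fun k : 'I_#|D| => enum_val k) Ac^T = 0.
  apply: etrans kv; apply/rowP => i; rewrite !mxE.
  rewrite [RHS](bigID (mem D)) /= [X in _ = _ + X]big1 ?addr0; last first.
    by move=> j; rewrite inE negbK => /eqP->; rewrite mul0r.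
  rewrite [RHS]big_enum_val; apply: eq_bigr => k _; by rewrite !mxE.
apply/negP => fA; move: uA => /eqP; rewrite mulmx_free_eq0 // => /eqP u0.
case/negP: v0; apply/eqP/rowP => j; rewrite [RHS]mxE; apply/eqP/negPn/negP => vj.
have jD : j \in D by rewrite inE.
have /rowP/(_ (enum_rank_in jD j)) := u0; rewrite !mxE enum_rankK_in //.
by move/eqP; apply/negP.
Qed.

Lemma circuit_nonempty D : D \in circuits A -> exists j, j \in D.
Proof.
rewrite inE => /minsetP[dD _]; apply/set0Pn; apply: contraTneq dD => ->.
rewrite negbK /row_free.
by have := rank_leq_row (rowsub (fun k : 'I_#|finset.set0 : {set 'I_n}| => enum_val k) A^T);
  rewrite [X in (_ <= X)%N -> _ == X]cards0 leqn0.
Qed.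

(** Subtracting a multiple of a circuit vector inside the support of [v] kills a coordinate without
    enlarging the support. Statements about the kernel thus reduce to circuits within a given
    support. *)
Lemma circuit_span v : v *m Ac^T = 0 -> exists a : {set 'I_n} -> C,
  (forall D, a D != 0 -> D \in circuits A /\ forall j, j \in D -> v 0 j != 0) /\
  v = \sum_D a D *: circuit_row D.
Proof.
have [m] := ubnP #|[set j | v 0 j != 0]|; elim: m v => // m IHm v lem kv.
have [->|v0] := eqVneq v 0.
  exists (fun=> 0); split=> [D|]; first by rewrite eqxx.
  by rewrite big1 // => D _; rewrite scale0r.
have [D mD sD] := minset_exists (dependent_support kv v0).
have cD : D \in circuits A by rewrite inE.
have [j jD] := circuit_nonempty cD.
have cj : circuit_row D 0 j != 0 by rewrite circuit_row_neq0.
pose c := v 0 j / circuit_row D 0 j; pose v' := v - c *: circuit_row D.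
have v'j k : v' 0 k = v 0 k - c * circuit_row D 0 k by rewrite !mxE.
have sv' k : v' 0 k != 0 -> (v 0 k != 0) && (k != j).
  rewrite v'j => H; apply/andP; split.
    apply: contraNneq H => vk; rewrite vk.
    have kD : k \notin D by apply/negP => /(fintype.subsetP sD); rewrite inE vk eqxx.
    by move: kD; rewrite -circuit_row_neq0 // negbK => /eqP->; rewrite mulr0 subr0.
  by apply: contraNneq H => ->; rewrite /c divfK // subrr.
have [||a [aP v'E]] := IHm v'.
- rewrite -ltnS; apply: leq_trans lem; rewrite ltnS; apply: proper_card; apply/properP; split.
    by apply/fintype.subsetP => k; rewrite !inE => /sv'/andP[].
  exists j; first by have := fintype.subsetP sD j jD.
  by rewrite inE negbK v'j /c divfK // subrr.
- by rewrite mulmxBl kv -scalemxAl circuit_row_ker // scaler0 subrr.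
exists (fun E => a E + (if E == D then c else 0)); split=> [E|].
  case: (eqVneq E D) => [->|_] aE.
    by split=> // k kD; have := fintype.subsetP sD k kD; rewrite inE.
  rewrite /= addr0 in aE; have [cE H] := aP E aE; split=> // k /H /sv'/andP[] //.
rewrite (eq_bigr (fun E => a E *: circuit_row E + (if E == D then c else 0) *: circuit_row E)).
  rewrite big_split /= -v'E (bigD1 D) //= eqxx big1 ?addr0 ?subrK //.
  by move=> E /negPf->; rewrite scale0r.
by move=> E _; rewrite scalerDl.
Qed.

Lemma circuit_poly_eval D p : D \in circuits A ->
  (circuit_poly (cv D)).@[p 0] =
  \sum_(i in D) circuit_row D 0 i * \prod_(j in D :\ i) p 0 j.
Proof.
move=> cD; rewrite /circuit_poly (proj2 (cvP cD)) rmorph_sum; apply: eq_bigr => i _.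
rewrite rmorphM /= mevalC !mxE rmorph_prod; congr (_ * _).
by apply: eq_bigr => j _; rewrite /= mevalXU.
Qed.

Lemma circuit_poly_homog D : D \in circuits A ->
  circuit_poly (cv D) \is #|D|.-1.-homog.
Proof.
move=> cD; rewrite /circuit_poly (proj2 (cvP cD)); apply: rpred_sum => i iD.
rewrite mul_mpolyC; apply: rpredZ.
have -> : #|D|.-1 = #|D :\ i| by rewrite (cardsD1 i D) iD.
exact: dhomog_prodX.
Qed.

Definition gradient_pairing D p w : C :=
  \sum_j ((circuit_poly (cv D))^`M(j)).@[p 0] * w 0 j.

Lemma gradient_pairingE D p w : D \in circuits A ->
  gradient_pairing D p w =
  \sum_(i in D) \sum_(j in D :\ i)
    circuit_row D 0 i * w 0 j * \prod_(k in D :\ i :\ j) p 0 k.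
Proof.
move=> cD; rewrite /gradient_pairing.
under eq_bigr => j _.
  rewrite /circuit_poly (proj2 (cvP cD)) (raddf_sum (mderiv j)) (raddf_sum (meval (p 0))) mulr_suml.
  over.
rewrite [LHS]exchange_big /=; apply: eq_bigr => i iD; rewrite [RHS]big_mkcond.
apply: eq_bigr => j _.
rewrite mderiv_mulC mderiv_prodX rmorphM /= mevalC.
have -> : ((cv D i 0)%:C)%C = circuit_row D 0 i by rewrite !mxE.
case: ifP => jD; last by rewrite meval0 mulr0 mul0r.
rewrite rmorph_prod mulrAC; congr (_ * _); apply: eq_bigr => k _.
by rewrite /= mevalXU.
Qed.

Lemma sum_circuit_span v (a : {set 'I_n} -> C) (P : pred 'I_n) (h : 'I_n -> C) :
  v = \sum_D a D *: circuit_row D ->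
  (forall D, a D != 0 -> \sum_(j | P j) circuit_row D 0 j * h j = 0) ->
  \sum_(j | P j) v 0 j * h j = 0.
Proof.
move=> -> H; under eq_bigr => j _ do rewrite summxE mulr_suml.
rewrite exchange_big big1 // => D _; have [aD|/H HD] := eqVneq (a D) 0.
  by rewrite big1 // => j _; rewrite aD scale0r mxE mul0r.
transitivity (a D * \sum_(j | P j) circuit_row D 0 j * h j).
  by rewrite mulr_sumr; apply: eq_bigr => j _; rewrite rowZ mulrA.
by rewrite HD mulr0.
Qed.

Section AtPoint.
Variable p : 'rV[C]_n.
Let S := [set j | p 0 j != 0]%SET.

Lemma gradient_pairing_regular D w : D \in circuits A -> D \subset S ->
  \sum_(j in D) circuit_row D 0 j * (p 0 j)^-1 = 0 ->
  gradient_pairing D p w =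
  - (\prod_(j in D) p 0 j) * \sum_(j in D) circuit_row D 0 j * (w 0 j / p 0 j ^+ 2).
Proof.
move=> cD DS inv; have p0 j : j \in D -> p 0 j != 0.
  by move=> jD; have := fintype.subsetP DS j jD; rewrite inE.
rewrite gradient_pairingE //; set P := \prod_(j in D) p 0 j.
pose W := \sum_(j in D) w 0 j / p 0 j.
transitivity (\sum_(i in D) (P * W * (circuit_row D 0 i * (p 0 i)^-1) -
    P * (circuit_row D 0 i * (w 0 i / p 0 i ^+ 2)))); last first.
  by rewrite big_split /= -mulr_sumr inv mulr0 add0r sumrN -mulr_sumr mulNr.
apply: eq_bigr => i iD.
transitivity (\sum_(j in D :\ i) P * circuit_row D 0 i / p 0 i * (w 0 j / p 0 j)).
  apply: eq_bigr => j /setD1P[ji jD].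
  have jDi : j \in D :\ i by rewrite !inE ji.
  have -> : P = p 0 i * (p 0 j * \prod_(k in D :\ i :\ j) p 0 k).
    by rewrite /P (big_setD1 i) //= (big_setD1 j).
  by have pi := p0 i iD; have pj := p0 j jD; field; rewrite pi pj.
rewrite -mulr_sumr.
have -> : \sum_(j in D :\ i) w 0 j / p 0 j = W - w 0 i / p 0 i.
  by rewrite /W [in RHS](big_setD1 i) //= addrAC subrr add0r.
by have pi := p0 i iD; field.
Qed.

(** As p_a = p_b = 0, a second-order term survives only if the two indices it omits are [a] and
    [b]. *)
Lemma gradient_pairing_pair D w a b : D \in circuits A ->
  a \in D -> b \in D -> a != b -> a \notin S -> b \notin S ->
  gradient_pairing D p w =
  (circuit_row D 0 b * w 0 a + circuit_row D 0 a * w 0 b) *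
  \prod_(k in D :\ a :\ b) p 0 k.
Proof.
move=> cD aD bD ab; rewrite !inE !negbK => /eqP pa /eqP pb.
have bDa : b \in D :\ a by rewrite !inE eq_sym ab.
have aDb : a \in D :\ b by rewrite !inE ab.
have p0 i j k : k \in D -> k != i -> k != j -> p 0 k = 0 ->
    \prod_(k in D :\ i :\ j) p 0 k = 0.
  move=> kD ki kj pk; rewrite (big_setD1 k) /= ?pk ?mul0r //.
  by rewrite !inE ki kj.
rewrite gradient_pairingE // (big_setD1 a) //= [X in _ + X](big_setD1 b bDa) /=.
rewrite [X in _ + (_ + X)]big1 ?addr0; last first.
  move=> i /setD1P[ib /setD1P[ia iD]]; rewrite big1 // => j /setD1P[ji jD].
  have [ja|ja] := eqVneq j a.
    by rewrite (p0 _ _ b) ?mulr0 // 1?eq_sym // ja.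
  by rewrite (p0 _ _ a) ?mulr0 // eq_sym.
rewrite (big_setD1 b bDa) /= [X in _ + X + _]big1 ?addr0; last first.
  move=> j /setD1P[jb /setD1P[ja jD]].
  by rewrite (p0 _ _ b) ?mulr0 // eq_sym.
rewrite [X in _ + X](big_setD1 a aDb) /= [X in _ + (_ + X)]big1 ?addr0; last first.
  move=> j /setD1P[ja /setD1P[jb jD]].
  by rewrite (p0 _ _ a) ?mulr0 // eq_sym.
rewrite [D :\ b :\ a](_ : _ = D :\ a :\ b) ?mulrDl 1?addrC //.
by apply/setP => k; rewrite !inE andbCA.
Qed.

Hypothesis vanish : forall D, D \in circuits A -> (circuit_poly (cv D)).@[p 0] = 0.

(** If [a] were the only zero of [p] on [D], a single, nonzero term of the circuit polynomial would
    remain. *)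
Lemma circuit_second_zero D a : D \in circuits A -> a \in D -> a \notin S ->
  exists b, [/\ b \in D, b != a & b \notin S].
Proof.
move=> cD aD; rewrite inE negbK => /eqP pa.
case: (boolP [exists b in D, (b != a) && (b \notin S)]) => [/exists_inP[b bD /andP[]]|].
  by exists b.
move=> /exists_inPn H; have := vanish cD; rewrite circuit_poly_eval // (big_setD1 a) //=.
rewrite [X in _ + X]big1 ?addr0; last first.
  move=> i /setD1P[ia iD]; rewrite (big_setD1 a) /= ?pa ?mul0r ?mulr0 //.
  by rewrite !inE eq_sym ia.
move/eqP; rewrite mulf_eq0 (negbTE (_ : _ != 0)) ?circuit_row_neq0 //=.
suff /negPf-> : \prod_(j in D :\ a) p 0 j != 0 by [].
apply/prodf_neq0 => j /setD1P[ja jD]; have := H j jD.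
by rewrite ja /= negbK inE.
Qed.

Lemma circuit_inverse D : D \in circuits A -> D \subset S ->
  \sum_(j in D) circuit_row D 0 j * (p 0 j)^-1 = 0.
Proof.
move=> cD DS; have p0 j : j \in D -> p 0 j != 0.
  by move=> jD; have := fintype.subsetP DS j jD; rewrite inE.
have P0 : \prod_(j in D) p 0 j != 0 by apply/prodf_neq0 => j /p0.
apply: (mulfI P0); rewrite mulr0; have := vanish cD.
rewrite circuit_poly_eval // => E; apply: etrans E; rewrite mulr_sumr.
apply: eq_bigr => i iD; rewrite (big_setD1 i) //=.
by have pi := p0 i iD; field.
Qed.

Lemma support_flat : is_flat Ac S.
Proof.
move=> v j kv jS vj; have [a [aP vE]] := circuit_span kv.
have [D aD jD] : exists2 D, a D != 0 & circuit_row D 0 j != 0.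
  case: (boolP [exists D, (a D != 0) && (circuit_row D 0 j != 0)]).
    by case/existsP => D /andP[]; exists D.
  move=> /existsPn H; move: vj; rewrite vE summxE big1 ?eqxx // => D _.
  have := H D; rewrite negb_and !negbK rowZ.
  by case/orP => /eqP->; rewrite ?mul0r ?mulr0.
have [cD Dv] := aP D aD; rewrite circuit_row_neq0 // in jD.
have [b [bD bj bS]] := circuit_second_zero cD jD jS.
by exists b => //; rewrite bj Dv.
Qed.

Lemma support_inverse : exists y : 'rV_d, forall j, j \in S -> (y *m Ac) 0 j = (p 0 j)^-1.
Proof.
have [v kv sv|y yE] := @row_interpolation _ _ _ Ac S (\row_j (p 0 j)^-1).
  have [a [aP vE]] := circuit_span kv.
  under eq_bigr => j _ do rewrite mulrC.
  apply: (sum_circuit_span vE) => D aD; have [cD Dv] := aP D aD.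
  have DS : D \subset S.
    by apply/fintype.subsetP => j /Dv; apply: contraNT => /sv->.
  apply: etrans (circuit_inverse cD DS); rewrite [LHS]big_mkcond [RHS]big_mkcond.
  apply: eq_bigr => j _; rewrite [(\row__ _) _ _]mxE.
  case: ifPn => jS; case: ifPn => // jD; last by rewrite (fintype.subsetP DS) in jS.
  by move: jD; rewrite -circuit_row_neq0 // negbK => /eqP->; rewrite mul0r.
by exists y => j /yE; rewrite [X in _ = X -> _]mxE.
Qed.

(** Circuits inside [S] give the first tangency condition and circuits with two elements outside of
    [S] the second. One element outside is impossible by [circuit_second_zero], and three or more
    make the gradient vanish at [p]. *)
Lemma gradient_kernel w :
  (forall D, D \in circuits A -> gradient_pairing D p w = 0) <-> tangent Ac S p w.
Proof.
have prodD D : D \subset S -> \prod_(j in D) p 0 j != 0.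
  by move=> DS; apply/prodf_neq0 => j /(fintype.subsetP DS); rewrite inE.
have sumS D : D \in circuits A -> D \subset S ->
    \sum_(j in S) circuit_row D 0 j * (w 0 j / p 0 j ^+ 2) =
    \sum_(j in D) circuit_row D 0 j * (w 0 j / p 0 j ^+ 2).
  move=> cD DS; rewrite [LHS]big_mkcond [RHS]big_mkcond.
  apply: eq_bigr => j _.
  case: ifPn => jS; case: ifPn => // jD; last by rewrite (fintype.subsetP DS) in jS.
  by move: jD; rewrite -circuit_row_neq0 // negbK => /eqP->; rewrite mul0r.
split=> [H|[t1 t2] D cD].
  split=> [v kv sv|a b v aS bS ab kv sv]; have [c [cP vE]] := circuit_span kv.
    under eq_bigr => j _ do rewrite -mulrA.
    apply: (sum_circuit_span vE) => D cD0; have [cD Dv] := cP D cD0.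
    have DS : D \subset S.
      by apply/fintype.subsetP => j /Dv; apply: contraNT => /sv->.
    rewrite sumS //; have := H D cD.
    rewrite gradient_pairing_regular ?circuit_inverse // => /eqP.
    by rewrite mulf_eq0 oppr_eq0 (negbTE (prodD D DS)) => /eqP.
  pose h j := if j == b then w 0 a else if j == a then w 0 b else 0.
  have hE x : x 0 b * w 0 a + x 0 a * w 0 b = \sum_j x 0 j * h j.
    rewrite (bigD1 b) //= (bigD1 a) //= big1 ?addr0 /h ?eqxx ?(negbTE ab) //.
    by move=> j /andP[/negPf-> /negPf->]; rewrite mulr0.
  rewrite hE; apply: (sum_circuit_span vE) => D cD0; have [cD Dv] := cP D cD0.
  rewrite -hE.
  have Dab j : j \in D -> j \notin S -> (j == a) || (j == b).
    move=> /Dv vj jS; apply: contraT; rewrite negb_or => /andP[ja jb].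
    by move: vj; rewrite sv ?eqxx // !in_setU1 !negb_or ja jb.
  have Dout j : j \notin D -> circuit_row D 0 j = 0.
    by move=> jD; apply/eqP/negPn; rewrite circuit_row_neq0.
  have [aD|aD] := boolP (a \in D); last first.
    have [bD|bD] := boolP (b \in D); last by rewrite !Dout // !mul0r addr0.
    have [k [kD kb kS]] := circuit_second_zero cD bD bS.
    by have := Dab k kD kS; rewrite (negbTE kb) orbF => /eqP ka; rewrite -ka kD in aD.
  have [k [kD ka kS]] := circuit_second_zero cD aD aS.
  have bD : b \in D by have := Dab k kD kS; rewrite (negbTE ka) /= => /eqP<-.
  have := H D cD; rewrite (gradient_pairing_pair w cD aD bD ab aS bS) => /eqP.
  rewrite mulf_eq0 => /orP[/eqP//|]; rewrite (negbTE (_ : _ != 0)) //.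
  apply/prodf_neq0 => j /setD1P[jb /setD1P[ja jD]].
  have jS : j \in S.
    by apply: contraT => /(Dab j jD); rewrite (negbTE ja) (negbTE jb).
  by rewrite inE in jS.
have Dout j : j \notin D -> circuit_row D 0 j = 0.
  by move=> jD; apply/eqP/negPn; rewrite circuit_row_neq0.
have kD := circuit_row_ker cD.
have [DS|] := boolP (D \subset S).
  rewrite gradient_pairing_regular ?circuit_inverse // -sumS //.
  suff -> : \sum_(j in S) circuit_row D 0 j * (w 0 j / p 0 j ^+ 2) = 0 by rewrite mulr0.
  under eq_bigr => j _ do rewrite mulrA.
  apply: t1 => // j jS; apply: Dout; apply: contra jS; exact: fintype.subsetP.
case/subsetPn => a aD aS; have [b [bD ba bS]] := circuit_second_zero cD aD aS.
rewrite (gradient_pairing_pair w cD aD bD _ aS bS) 1?eq_sym //.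
case: (boolP [exists k in D, (k != a) && (k != b) && (k \notin S)]).
  case/exists_inP => k kD' /andP[/andP[ka kb]]; rewrite inE negbK => /eqP pk.
  by rewrite (big_setD1 k) /= ?pk ?mul0r ?mulr0 // !inE ka kb.
move=> /exists_inPn H; rewrite t2 ?mul0r 1?eq_sym // => j.
rewrite !in_setU1 !negb_or => /and3P[ja jb jS]; apply: Dout.
by apply: contraL jS => jD; have := H j jD; rewrite ja jb.
Qed.

End AtPoint.
End Circuits.

(** * Ideals generated by a set *)

Section IdealSpan.
Variable S : comNzRingType.
Implicit Types (G : set S) (f g : S).

Lemma ideal_span_gen G f : G f -> ideal_span G f.
Proof.
move=> Gf; exists [:: (1, f)]; first by move=> cg; rewrite inE => /eqP->.
by rewrite big_seq1 mul1r.
Qed.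

Lemma ideal_span0 G : ideal_span G 0.
Proof. by exists [::] => //; rewrite big_nil. Qed.

Lemma ideal_span_mul G f g : ideal_span G f -> ideal_span G (f * g).
Proof.
move=> [s sG ->]; exists [seq (cg.1 * g, cg.2) | cg <- s].
  by move=> _ /mapP[cg /sG ? ->].
by rewrite big_map mulr_suml; apply: eq_bigr => cg _; rewrite mulrAC.
Qed.

Lemma ideal_span_rmorph0 (T : comNzRingType) (h : {rmorphism S -> T}) G f :
  (forall g, G g -> h g = 0) -> ideal_span G f -> h f = 0.
Proof.
move=> Gh [s sG ->]; rewrite rmorph_sum big_seq big1 // => cg /sG /Gh hg.
by rewrite rmorphM hg mulr0.
Qed.

End IdealSpan.

(** * Curves in the reciprocal plane through a given point *)

Section CurveTangent.
Variables (C : numClosedFieldType) (d n : nat) (A : 'M[C]_(d, n)).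
Hypothesis realA : map_mx Num.conj A = A.

(** For u = (y1 + s y0 + s^2 z) A, the points s/u tend to [p] as s tends to 0, with velocity - p^2
    (z A) on [S] and 1/(y1 A) outside. [G] vanishes along this curve, and [tangent_spanned] applies
    to its gradient. *)
Lemma homog_tangent (G : {mpoly C[n]}) k (p w : 'rV[C]_n) (y0 : 'rV[C]_d)
    (S : {set 'I_n}) :
  (forall j, (j \in S) = (p 0 j != 0)) -> is_flat A S ->
  (forall j, j \in S -> (y0 *m A) 0 j = (p 0 j)^-1) ->
  G \is k.-homog ->
  (forall y : 'rV_d, (forall j, (y *m A) 0 j != 0) -> G.@[fun j => ((y *m A) 0 j)^-1] = 0) ->
  tangent A S p w ->
  \sum_j (G^`M(j)).@[p 0] * w 0 j = 0.
Proof.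
move=> pS fS y0E homG GV tw.
pose g : 'rV[C]_n := \row_j (G^`M(j)).@[p 0].
transitivity (\sum_j g 0 j * w 0 j).
  by apply: eq_bigr => j _; rewrite [g _ _]mxE.
apply: (tangent_spanned realA fS _ _ tw) => [j|z y1 Sy1 y1Z].
  by rewrite pS.
pose a j := (y0 *m A) 0 j; pose b j := (z *m A) 0 j; pose c j := (y1 *m A) 0 j.
pose den j : {poly C} := if j \in S then (a j)%:P + b j *: 'X
  else (c j)%:P + a j *: 'X + b j *: 'X^2.
pose num j : {poly C} := if j \in S then 1 else 'X.
pose D := \prod_j den j.
have den0 j : (den j).[0] = if j \in S then a j else c j.
  rewrite /den; case: ifP => _;
  by rewrite !(hornerD, hornerC, hornerZ, hornerX, hornerXn) ?expr0n /= !mulr0 !addr0.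
have den0_neq0 j : (den j).[0] != 0.
  rewrite den0; case: ifPn => jS; last exact: y1Z.
  by rewrite /a y0E // invr_eq0 -pS.
have D0 : D.[0] != 0 by rewrite horner_prod; apply/prodf_neq0.
(* The Taylor polynomial of degree 1 of 1/D at 0. Since [de * D] is 1 + O(s^2), clearing
   denominators changes neither the point nor the velocity at 0. *)
pose de : {poly C} := (D.[0]^-1)%:P - (D^`().[0] / D.[0] ^+ 2) *: 'X.
pose X j := num j * \prod_(k | k != j) den k.
have XE j : X j * den j = num j * D.
  by rewrite /X /D [in RHS](bigD1 j) //= -mulrA; congr (_ * _); rewrite mulrC.
pose Y j := de * X j.
have YE j : Y j * den j = num j * (de * D) by rewrite /Y -mulrA XE mulrCA.
have deD0 : (de * D).[0] = 1.
  rewrite hornerM /de hornerD hornerN hornerZ hornerX hornerC mulr0 subr0.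
  by rewrite mulVf.
have deD1 : (de * D)^`().[0] = 0.
  rewrite derivM hornerD !hornerM /de derivB derivC derivZ derivX sub0r.
  rewrite !(hornerD, hornerN, hornerZ, hornerX, hornerC) mulr0 subr0 mulr1.
  by field.
have Y0 j : (Y j).[0] = p 0 j.
  apply: (mulIf (den0_neq0 j)); rewrite -hornerM YE hornerM deD0 mulr1 den0 /num.
  case: ifPn => jS; first by rewrite hornerC /a y0E // divff // -pS.
  by move: jS; rewrite pS negbK hornerX => /eqP->; rewrite mul0r.
have Y1 j : (Y j)^`().[0] = if j \in S then - p 0 j ^+ 2 * b j else (c j)^-1.
  have E : (Y j)^`().[0] * (den j).[0] + p 0 j * (den j)^`().[0] = (num j)^`().[0].
    rewrite -[p 0 j]Y0 -!hornerM -hornerD -derivM YE derivM hornerD hornerM [X in _ + X]hornerM.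
    by rewrite deD0 deD1 mulr1 mulr0 addr0.
  apply: (mulIf (den0_neq0 j)); move: E; rewrite den0 /den /num.
  case: ifPn => jS; rewrite !(derivD, derivC, derivZ, derivX, derivXn).
    have pj : p 0 j != 0 by rewrite -pS.
    rewrite !(hornerD, hornerZ, hornerC) add0r mulr1 => E.
    by rewrite -[LHS](addrK (p 0 j * b j)) E /a y0E //; field.
  move: (jS); rewrite pS negbK => /eqP->; rewrite mul0r addr0 hornerC => ->.
  by rewrite mulVf // y1Z.
have P0 : mmap polyC Y G = 0.
  apply: (@poly_eq0_cofinite _ _ ('X * D)).
    rewrite mulf_neq0 ?polyX_eq0 //.
    by apply: contraNneq D0 => ->; rewrite horner0.
  move=> s; rewrite hornerM hornerX mulf_eq0 negb_or => /andP[s0 Ds].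
  pose y := y1 + s *: y0 + s ^+ 2 *: z.
  have uE j : (y *m A) 0 j = (if j \in S then s else 1) * (den j).[s].
    rewrite !mulmxDl -!scalemxAl !rowD !rowZ -/(a j) -/(b j) -/(c j) /den.
    case: ifP => jS; rewrite !(hornerD, hornerC, hornerZ, hornerX, hornerXn).
      by rewrite /c Sy1 // add0r; ring.
    by ring.
  have dens j : (den j).[s] != 0.
    by move: Ds; rewrite /D horner_prod => /prodf_neq0; apply.
  have u0 j : (y *m A) 0 j != 0.
    by rewrite uE mulf_neq0 //; case: ifP => _; rewrite ?s0 ?oner_eq0.
  rewrite horner_mmap (@meval_homog _ _ _ _ (de.[s] * s * D.[s])
    (fun j => ((y *m A) 0 j)^-1) _ homG) => [|j].
    by rewrite (GV y u0) mulr0.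
  apply: (mulIf (u0 j)); rewrite mulfVK // uE.
  have := congr1 (fun q : {poly C} => q.[s]) (YE j).
  rewrite !hornerM /num => E; rewrite mulrCA E.
  by case: ifP => _; rewrite ?hornerC ?hornerX; ring.
have := congr1 (fun q : {poly C} => q^`().[0]) P0.
rewrite /= deriv0 horner0 deriv_mmap horner_sum => E; apply: etrans E.
rewrite [RHS](bigID (mem S)) /=; congr (_ + _); apply: eq_bigr => j jS;
  rewrite hornerM horner_mmap Y1 [g _ _]mxE.
  by rewrite jS; congr (_ * _); apply: meval_eq => i; rewrite Y0.
by rewrite (negbTE jS); congr (_ * _); apply: meval_eq => i; rewrite Y0.
Qed.

End CurveTangent.

Lemma row_neq0_dim (V : nmodType) n (p : 'rV[V]_n) : p != 0 -> (0 < n)%N.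
Proof. by case: n p => // p /eqP[]; apply/rowP => -[]. Qed.

(** * The Jacobian at points of the reciprocal plane *)

Section ReciprocalPlanePoints.
Variables (R : realType) (d n : nat) (A : 'M[R]_(d, n)).
Variable cv : {set 'I_n} -> 'cV[R]_n.
Hypothesis rankA : \rank A = d.
Hypothesis cvP : circuit_vectors A cv.
Local Notation C := R[i].
Local Notation Ac := (map_mx (real_complex R) A).
Local Notation X := (reciprocal_plane A).
Local Notation inv_point y := (map_mx GRing.inv (y *m Ac)).
Implicit Types (v w p : 'rV[C]_n) (D : {set 'I_n}) (y : 'rV[C]_d).
Implicit Types (f g : {mpoly C[n]}).

Let realA := real_Ac A.
Let freeA := row_free_Ac rankA.

Definition jac_at p := map_mx (meval (p 0)) (jac A cv).

Definition nonzero_coords y := forall j, (y *m Ac) 0 j != 0.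

Lemma jac_at_kernel p w : jac_at p *m w^T = 0 <->
  (forall D, D \in circuits A -> gradient_pairing cv D p w = 0).
Proof.
have E k : (jac_at p *m w^T) k 0 = gradient_pairing cv (enum_val k) p w.
  by rewrite mxE; apply: eq_bigr => j _; rewrite !mxE.
split=> [H D cD|H].
  by have /matrixP/(_ (enum_rank_in cD D) 0) := H; rewrite E enum_rankK_in // mxE.
by apply/matrixP => k i; rewrite ord1 E mxE H // enum_valP.
Qed.

Lemma nonzero_torus y : nonzero_coords y -> reciprocal_torus A (inv_point y).
Proof. by move=> y0; exists y. Qed.

Lemma torus_sub p : p != 0 -> reciprocal_torus A p -> X p.
Proof.
move=> p0 tp; split=> // f _; apply: (ideal_span_rmorph0 (h := meval (p 0))).
by move=> g [_]; apply.
Qed.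

(** Forms vanishing on the torus part vanish on its closure by definition. Conversely, 0 < n makes
    the torus vectors nonzero, so that they are points of the closure. *)
Lemma proj_ideal_torus f : (0 < n)%N ->
  proj_ideal (reciprocal_torus A) f <-> proj_ideal X f.
Proof.
move=> n0; split=> -[s sG ->]; exists s => // cg /sG [hg Hg]; split=> // p Xp.
  by have [_ H] := Xp; apply: H => //; apply: ideal_span_gen.
apply: Hg; apply: torus_sub => //; case: Xp => y [y0 ->].
apply/eqP => /rowP/(_ (Ordinal n0)); rewrite !mxE => /eqP; apply/negP.
by rewrite invr_eq0; have := y0 (Ordinal n0); rewrite mxE.
Qed.

Lemma inv_pointE y j : inv_point y 0 j = ((y *m Ac) 0 j)^-1.
Proof. by rewrite mxE. Qed.

Lemma circuit_poly_inv_point D y : D \in circuits A -> nonzero_coords y ->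
  (circuit_poly (cv D)).@[inv_point y 0] = 0.
Proof.
move=> cD y0; rewrite (circuit_poly_eval cvP) //.
set u := (y *m Ac) 0; pose P := \prod_(j in D) (u j)^-1.
transitivity (P * \sum_(i in D) u i * circuit_row cv D 0 i).
  rewrite mulr_sumr; apply: eq_bigr => i iD.
  have -> : P = (u i)^-1 * \prod_(j in D :\ i) (u j)^-1 by rewrite /P (big_setD1 i).
  rewrite mulrACA mulVf ?mul1r; last exact: y0.
  by rewrite mulrC; congr (_ * _); apply: eq_bigr => j _; rewrite inv_pointE.
rewrite pairing_supported ?mulr0 //; first exact: circuit_row_ker.
by move=> j jD; apply/eqP/negPn; rewrite (circuit_row_neq0 cvP).
Qed.

Lemma circuit_poly_in_ideal D : D \in circuits A ->
  proj_ideal (reciprocal_torus A) (circuit_poly (cv D)).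
Proof.
move=> cD; apply: ideal_span_gen; split.
  by exists #|D|.-1; apply: (circuit_poly_homog cvP).
by move=> p [y [y0 ->]]; apply: circuit_poly_inv_point.
Qed.

Lemma circuit_poly_vanish D p : D \in circuits A -> X p ->
  (circuit_poly (cv D)).@[p 0] = 0.
Proof.
move=> cD [_ H]; apply: H; last exact: circuit_poly_in_ideal.
by exists #|D|.-1; apply: (circuit_poly_homog cvP).
Qed.

Section AtPoint.
Variable p : 'rV[C]_n.
Hypothesis Xp : X p.
Let S := [set j | p 0 j != 0]%SET.

Lemma dim_gt0 : (0 < n)%N.
Proof.
by case: Xp => p0 _; apply: row_neq0_dim p0.
Qed.

Let vanishp D : D \in circuits A -> (circuit_poly (cv D)).@[p 0] = 0.
Proof. by move=> cD; apply: circuit_poly_vanish. Qed.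

Let flatS : is_flat Ac S := support_flat cvP vanishp.

Let inS j : (j \in S) = (p 0 j != 0). Proof. by rewrite inE. Qed.

Lemma jac_at_tangent w : jac_at p *m w^T = 0 <-> tangent Ac S p w.
Proof.
by rewrite jac_at_kernel; apply: gradient_kernel.
Qed.

(** The homogeneous generators vanish at [p], so by Leibniz only multiples of their gradients
    remain, and [homog_tangent] handles these. *)
Lemma ideal_tangent f w : proj_ideal X f -> tangent Ac S p w ->
  \sum_j (f^`M(j)).@[p 0] * w 0 j = 0.
Proof.
move=> /(proj_ideal_torus _ dim_gt0).2 [s sG ->] tw.
have [y0 y0E] := support_inverse cvP vanishp.
have H cg : cg \in s ->
    cg.2.@[p 0] = 0 /\ \sum_j (cg.2^`M(j)).@[p 0] * w 0 j = 0.
  move=> /[dup] cgs /sG [[k hk] Hk]; split.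
    by have [_ Hp] := Xp; apply: Hp; [exists k | apply: ideal_span_gen; apply: sG].
  apply: (homog_tangent realA inS flatS y0E hk _ tw) => y yn0.
  by rewrite -[RHS](Hk _ (nonzero_torus yn0)); apply: meval_eq => j; rewrite inv_pointE.
transitivity (\sum_(cg <- s) \sum_j ((cg.1 * cg.2)^`M(j)).@[p 0] * w 0 j).
  rewrite exchange_big /=; apply: eq_bigr => j _.
  by rewrite (raddf_sum (mderiv j)) (raddf_sum (meval (p 0))) mulr_suml.
rewrite big_seq big1 // => cg /H [g0 gw].
transitivity (cg.1.@[p 0] * \sum_j (cg.2^`M(j)).@[p 0] * w 0 j).
  rewrite mulr_sumr; apply: eq_bigr => j _.
  by rewrite mderivM rmorphD !rmorphM /= g0 mulr0 add0r mulrA.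
by rewrite gw mulr0.
Qed.

(** Gradients of elements of the ideal vanish on the kernel of the circuit Jacobian, so they lie in
    its row space; a smaller rank would make [p] singular. *)
Lemma jac_at_rank : ~ sing_locus (n - d) X p -> (n - d <= \rank (jac_at p))%N.
Proof.
move=> nsing; rewrite leqNgt; apply/negP => lt; apply: nsing; split=> // m F FX.
apply: leq_ltn_trans lt; apply: mxrankS; rewrite submxE; apply/eqP/matrixP => k c.
pose w := (col c (cokermx (jac_at p)))^T.
have tw : tangent Ac S p w.
  apply/jac_at_tangent; rewrite trmxK -col_mul mulmx_coker.
  by apply/matrixP => i j; rewrite !mxE.
rewrite [RHS]mxE -[RHS](ideal_tangent (FX k) tw) mxE; apply: eq_bigr => j _.
by rewrite !mxE.
Qed.

Lemma leq_dn : (d <= n)%N.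
Proof. by rewrite -rankA rank_leq_col. Qed.

(** The tangent space has dimension at most d, and A maps it onto C^d by [tangent_nondegenerate]. So
    A is injective on it, and the stacked matrix has trivial kernel. *)
Lemma real_regular_rank c (x : 'rV[R]_n) : c != 0 ->
  c *: p = map_mx (real_complex R) x -> (n - d <= \rank (jac_at p))%N ->
  \rank (col_mx Ac (jac_at p)) = n.
Proof.
move=> c0 px rJ; pose T := kermx (jac_at p)^T.
have TP w : (w <= T)%MS -> tangent Ac S p w.
  move=> /sub_kermxP wJ; apply/jac_at_tangent.
  by apply: trmx_inj; rewrite trmx_mul trmxK wJ trmx0.
have rT : (\rank T <= d)%N.
  by rewrite mxrank_ker mxrank_tr leq_subLR addnC -leq_subLR.
have pE : p = c^-1 *: map_mx (real_complex R) x by rewrite -px scalerA mulVf ?scale1r.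
have rx : real_row (map_mx (real_complex R) x).
  by apply/rowP => j; rewrite !mxE; apply/CrealP; rewrite complex_real.
have fr : row_free (T *m Ac^T)^T.
  apply/inj_row_free => y yT.
  apply: (tangent_nondegenerate realA freeA flatS inS _ rx pE) => [|w tw].
    by rewrite invr_eq0.
  have /submxP[z ->] : (w <= T)%MS.
    apply/sub_kermxP/trmx_inj; rewrite trmx_mul trmxK trmx0.
    exact/jac_at_tangent.
  rewrite pairingE -mulmxA trmx_mul mulmxA.
  by rewrite yT mul0mx mxE.
have rTA : \rank (T *m Ac^T) = d by rewrite -mxrank_tr; apply/eqP.
have := mxrank_mul_ker T Ac^T; rewrite rTA => rE.
have : \rank (T :&: kermx Ac^T)%MS = 0%N.
  by apply/eqP; rewrite -leqn0 -(leq_add2l d) rE addn0.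
move/eqP; rewrite mxrank_eq0 => /eqP TK.
rewrite -mxrank_tr; apply/eqP; rewrite -/(row_free _); apply/inj_row_free => w.
rewrite tr_col_mx mul_mx_row => wAJ.
have [wA wJ] : w *m Ac^T = 0 /\ w *m (jac_at p)^T = 0.
  by apply/eq_row_mx; rewrite wAJ row_mx0.
apply/eqP; rewrite -submx0 -TK sub_capmx; apply/andP.
by split; apply/sub_kermxP.
Qed.

End AtPoint.

(** * Ramification points on the torus *)

Section Ramified.
Variable y : 'rV[C]_d.
Hypothesis y0 : nonzero_coords y.
Let q := inv_point y.
Let S := [set j | q 0 j != 0]%SET.

Let inT j : j \in S.
Proof. by rewrite inE inv_pointE invr_eq0. Qed.

Lemma torus_tangent w : jac_at q *m w^T = 0 <->
  (forall v, v *m Ac^T = 0 -> \sum_j ((y *m Ac) 0 j) ^+ 2 * v 0 j * w 0 j = 0).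
Proof.
rewrite jac_at_kernel; apply: iff_trans (gradient_kernel cvP _ w) _.
  by move=> D cD; apply: circuit_poly_inv_point.
have E v : \sum_(j in S) v 0 j * w 0 j / q 0 j ^+ 2 =
    \sum_j ((y *m Ac) 0 j) ^+ 2 * v 0 j * w 0 j.
  apply: eq_big => [j|j _]; first by rewrite inT.
  by rewrite inv_pointE exprVn invrK mulrC mulrA.
split=> [[H _] v kv|H]; first by rewrite -E; apply: H => // j; rewrite inT.
by split=> [v kv _|a b v]; [rewrite E H | rewrite inT].
Qed.

(** The kernel of the Jacobian at 1/u is the row space divided entrywise by u^2, of dimension d. *)
Lemma torus_jac_rank : \rank (jac_at q) = (n - d)%N.
Proof.
pose D : 'rV[C]_n := \row_j ((y *m Ac) 0 j) ^- 2.
pose B := Ac *m diag_mx D.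
have rB : \rank B = d.
  rewrite mxrankMfree ?mxrank_map // row_free_unit unitmxE det_diag unitfE.
  by apply/prodf_neq0 => j _; rewrite mxE invr_eq0 sqrf_eq0.
have BE z j : (z *m B) 0 j = (z *m Ac) 0 j * ((y *m Ac) 0 j) ^- 2.
  by rewrite mulmxA mul_mx_diag [LHS]mxE [D _ _]mxE.
apply/eqP; rewrite eqn_leq; apply/andP; split.
  have JB : jac_at q *m B^T = 0.
    apply: trmx_inj; rewrite trmx0; apply/row_matrixP => i.
    rewrite row0 trmx_mul trmxK row_mul rowE.
    apply: trmx_inj; rewrite trmx0 trmx_mul trmxK; apply/torus_tangent => v kv.
    rewrite -[RHS](pairing0 (delta_mx 0 i) kv); apply: eq_bigr => j _.
    by rewrite BE; have yj := y0 j; field.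
  have := mulmx0_rank_max JB; rewrite mxrank_tr rB => H.
  by rewrite leq_subRL ?leq_dn // addnC.
rewrite leq_subLR addnC -leq_subLR -[(n - _)%N](_ : \rank (kermx (jac_at q)^T) = _).
  suff : (\rank (kermx (jac_at q)^T) <= \rank B)%N by rewrite rB.
  apply/mxrankS/rV_subP => w /sub_kermxP wJ.
  have /torus_tangent H : jac_at q *m w^T = 0.
    by apply: trmx_inj; rewrite trmx_mul trmxK wJ trmx0.
  have [v kv _|z zE] := @row_interpolation _ _ _ Ac [set: 'I_n]%SET
      (\row_j (((y *m Ac) 0 j) ^+ 2 * w 0 j)).
    rewrite -[RHS](H v kv); apply: eq_big => [j|j _]; first by rewrite inE.
    by rewrite mxE mulrAC.
  apply/submxP; exists z; apply/rowP => j; rewrite BE zE ?inE // mxE.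
  by have yj := y0 j; field.
by rewrite mxrank_ker mxrank_tr.
Qed.

(** Some (n-d)-minor m of the Jacobian is nonzero at [q], and f m^k lies in the ideal before
    saturation. That ideal vanishes at [q], since the common kernel vector [w] makes all n x n
    minors vanish there. *)
Lemma ramified_vanishing f :
  ramification_ideal A cv f -> ramified_at Ac y -> f.@[q 0] = 0.
Proof.
move=> [k Hk] [w [w0 kw Hw]].
have [h [g [hh hg det0]]] := minor_neq0 torus_jac_rank.
pose m := \det (mxsub h g (jac A cv)).
have mJ : minors (n - d) (jac A cv) m by exists h, g.
have mq : m.@[q 0] != 0 by rewrite -det_map_mx map_mxsub.
have [a [b [aI bI fE]]] : ideal_add (proj_ideal X) (ideal_span (minors n
    (col_mx (map_mx (fun a : R => (a%:C)%C%:MP) A) (jac A cv)))) (f * m ^+ k).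
  apply: Hk; apply: ideal_span_gen; exists (fun=> m); first by move=> _; apply: ideal_span_gen.
  by rewrite prodr_const card_ord.
have qn0 : q != 0.
  apply: contraNneq w0 => q0; apply/eqP/rowP => j; have := y0 j.
  by rewrite -invr_eq0 -inv_pointE -/q q0 mxE eqxx.
have Xq : X q by apply: torus_sub => //; apply: nonzero_torus.
have aq : a.@[q 0] = 0.
  by apply: (ideal_span_rmorph0 (h := meval (q 0))) aI => g' [_]; apply.
have bq : b.@[q 0] = 0.
  apply: (ideal_span_rmorph0 (h := meval (q 0))) bI => g'; apply: minor_eq0.
  rewrite map_col_mx -map_mx_comp.
  rewrite (_ : map_mx _ A = Ac); last first.
    by apply/matrixP => i j; rewrite !mxE /= mevalC.
  rewrite ltn_neqAle rank_leq_col andbT; apply: contraNneq w0 => rM.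
  have fr : row_free (col_mx Ac (jac_at q))^T by rewrite /row_free mxrank_tr rM.
  rewrite -(mulmx_free_eq0 _ fr) tr_col_mx mul_mx_row kw.
  suff -> : w *m (jac_at q)^T = 0 by rewrite row_mx0.
  apply: trmx_inj; rewrite trmx_mul trmxK trmx0; apply/torus_tangent.
  exact: Hw.
have := congr1 (meval (q 0)) fE; rewrite rmorphD rmorphM rmorphXn /= aq bq addr0.
by move/eqP; rewrite mulf_eq0 expf_eq0 (negbTE mq) andbF orbF => /eqP.
Qed.

End Ramified.

(** * The two inclusions *)

Lemma sing_sub_ramification :
  (sing_reciprocal_plane A `<=` ramification_scheme A cv)%classic.
Proof.
move=> p [Xp sing]; split; first by case: Xp.
move=> f [k homf] fR.
pose S := [set j | p 0 j != 0]%SET.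
have inS j : (j \in S) = (p 0 j != 0) by rewrite inE.
have vp D (cD : D \in circuits A) := circuit_poly_vanish cD Xp.
have flatS : is_flat Ac S := support_flat cvP vp.
have [e [e' gl]] := exists_generic_line realA flatS.
have rJ : (\rank (jac_at p) + d < n)%N.
  have rk : (\rank (jac_at p) < n - d)%N.
    (* Singularity is applied to the circuit polynomials themselves, which bounds the rank of
       [jac_at p]. *)
    have := sing #|circuits A| (fun k => circuit_poly (cv (enum_val k))).
    rewrite (_ : \matrix_(_, _) _ = jac_at p); last by apply/matrixP => i j; rewrite !mxE.
    apply=> i; apply/(proj_ideal_torus _ (dim_gt0 Xp)); apply: circuit_poly_in_ideal.
    exact: enum_valP.
  by rewrite addnC -ltn_subRL.
have [w0 w00 cw0] := class_vector_exists realA gl inS rJ (fun w => (jac_at_tangent Xp w).1).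
have [y yE] := support_inverse cvP vp.
have yS j : j \in S -> (y *m Ac) 0 j != 0.
  by move=> jS; rewrite yE // invr_eq0 -inS.
have HF z : (forall j, (z *m Ac) 0 j != 0) -> ramified_at Ac z ->
    f.@[fun j => ((z *m Ac) 0 j)^-1] = 0.
  move=> z0 rz; rewrite -[RHS](ramified_vanishing z0 fR rz).
  by apply: meval_eq => j; rewrite inv_pointE.
rewrite -[RHS](degenerate_limit_vanishing realA gl yS homf HF cw0 w00).
apply: meval_eq => j; rewrite /masked_inv; case: ifPn => jS.
  by rewrite yE // invrK.
by move: jS; rewrite inS negbK => /eqP.
Qed.

Lemma ideal_sub_ramification : (proj_ideal X `<=` ramification_ideal A cv)%classic.
Proof.
move=> f fX; exists 0%N => g _; exists (f * g), 0; split; last by rewrite addr0.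
  exact: ideal_span_mul.
exact: ideal_span0.
Qed.

Lemma real_ramification_sub p : real_points (ramification_scheme A cv) p ->
  sing_reciprocal_plane A p.
Proof.
move=> [[p0 Hp] [c c0 [x px]]].
have n0 : (0 < n)%N.
  exact: row_neq0_dim p0.
have Xp : X p.
  split=> // f hf /(proj_ideal_torus _ n0) fX; apply: Hp => //.
  exact: ideal_sub_ramification.
apply: contrapT => nsing.
have rk := real_regular_rank Xp c0 px (jac_at_rank Xp nsing).
pose M := col_mx (map_mx (fun a : R => (a%:C)%C%:MP) A) (jac A cv).
have Mp : map_mx (meval (p 0)) M = col_mx Ac (jac_at p).
  rewrite map_col_mx -map_mx_comp; congr col_mx.
  by apply/matrixP => i j; rewrite !mxE /= mevalC.
(* This minor lies in the ramification ideal with exponent 0 and is homogeneous: rows of A have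
   degree 0, the row of a circuit D has degree |D| - 2. So it would have to vanish at [p]. *)
have [h [g [hh hg /eqP]]] := minor_neq0 rk; apply.
rewrite -Mp -map_mxsub det_map_mx; apply: Hp.
  pose e i := match split (h i) with inl _ => 0%N | inr k => #|enum_val k|.-2 end.
  exists (\sum_i e i)%N; apply: dhomog_det => i j.
  rewrite mxE mxE /e; case: splitP => k _; rewrite mxE.
    by rewrite -[_%:MP]mulr1 mul_mpolyC; apply: rpredZ; apply: dhomog1.
  by apply: dhomog_mderiv; apply: (circuit_poly_homog cvP); apply: enum_valP.
exists 0%N => f _; exists 0, (\det (mxsub h g M) * f); split; last by rewrite add0r.
  exact: ideal_span0.
by apply: ideal_span_mul; apply: ideal_span_gen; exists h, g.
Qed.

End ReciprocalPlanePoints.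

Local Open Scope classical_set_scope.
Theorem theorem35 (R : realType) (d n : nat) (A : 'M[R]_(d, n))
    (cv : {set 'I_n} -> 'cV[R]_n)
    (rankA : \rank A = d)
    (no_zero_col : forall j : 'I_n, col j A != 0)
    (cvP : circuit_vectors A cv) :
  sing_reciprocal_plane A `<=` ramification_scheme A cv /\
  real_points (ramification_scheme A cv) =
    real_points (sing_reciprocal_plane A).
Proof.
have sub := sing_sub_ramification rankA cvP; split=> //.
apply/seteqP; split=> p [Xp rp]; split=> //; last exact: sub.
exact: (real_ramification_sub rankA cvP).
Qed.
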